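(* Let $t\ge 2$ be an integer and define $\delta(t)$ as below. Then for every $\alpha\in(0,1]$ and every election $(V,A,\succ)$ with $|A|\ge t$, there exists a $(t,\alpha)$-undominated set $C\subseteq A$ with $|C|\le \lfloor \delta(t)\cdot t/\alpha\rfloor$. Moreover $1<\delta(t)\le 4.75$ for every integer $t\ge2$, and $\delta(t)\to 1$ as $t\to\infty$.
   Context: An election $(V,A,\succ)$: finite nonempty voter set $V$ with $n=|V|$, finite candidate set $A$, and for each voter $v$ a strict linear order $\succ_v$ on $A$. For an integer $t\ge1$, a voter $v$, a set $C\subseteq A$ with $|C|\ge t$ and $a\in A\setminus C$: $C\succ_v^t a$ iff $|\{c\in C: c\succ_v a\}|\ge t$; otherwise we write $a\succ_v^t C$. A set $C\subseteq A$ is $(t,\alpha)$-undominated if $|C|\ge t$ and for every $a\in A\setminus C$, $|\{v\in V: a\succ_v^t C\}|\le\lfloor\alpha n\rfloor$. For $\gamma\ge1$ and integer $t\ge2$ let $$\omega(\gamma,t)=\left(\frac{e^{-\frac{\gamma t-t+1}{\gamma t}}}{\left(\frac{t-1}{\gamma t}\right)^{\frac{t-1}{\gamma t}}}\right)^{\gamma t}.$$ For $\alpha\in(0,1]$ let $$s_1(\alpha,t)=\inf\Big\{\tfrac{\gamma\tau}{\tau-1}\cdot\tfrac{1}{1-\omega(\gamma,t)\tau}\cdot\tfrac{t}{\alpha}+\log_\tau\!\Big(\tfrac{1}{1-\omega(\gamma,t)\tau}\cdot\tfrac1\alpha\Big)\ :\ \gamma\ge1,\ \tau>1,\ \tau\,\omega(\gamma,t)<1\Big\},$$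 $$s_2(\alpha,t)=\inf\Big\{B\in\mathbb{N}\ :\ \exists\gamma\ge1 \text{ with } \alpha\ge \tfrac{\gamma t}{B}+\omega(\gamma,t)\Big\},$$ and $\delta(t)=\sup_{\alpha\in(0,1]}\min\Big\{\tfrac{\alpha\, s_1(\alpha,t)}{t},\tfrac{\alpha\, s_2(\alpha,t)}{t}\Big\}$. *)

(* Defs.v *)
From HB Require Import structures.
From mathcomp Require Import all_boot all_order all_algebra.
From mathcomp Require Import all_classical all_reals all_analysis.
Set Implicit Arguments. Unset Strict Implicit. Unset Printing Implicit Defensive.
Import Order.TTheory GRing.Theory Num.Theory.
Local Open Scope classical_set_scope.
Local Open Scope ring_scope.

Definition strict_linear_order (A : finType) (r : rel A) : Prop :=
  irreflexive r /\ transitive r /\ (forall x y : A, x != y -> r x y || r y x).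

(* An election: every voter v has a strict linear order (pref v) on A;
   pref v x y means x >_v y. *)
Definition is_election (V A : finType) (pref : V -> rel A) : Prop :=
  (0 < #|V|)%N /\ forall v : V, strict_linear_order (pref v).

Definition beats_t (V A : finType) (pref : V -> rel A) (t : nat)
  (v : V) (C : {set A}) (a : A) : bool :=
  (t <= #|[set c in C | pref v c a]|)%N.

Definition undominated (R : realType) (V A : finType) (pref : V -> rel A)
  (t : nat) (alpha : R) (C : {set A}) : Prop :=
  (t <= #|C|)%N /\
  forall a : A, a \notin C ->
    ((#|[set v : V | ~~ beats_t pref t v C a]|)%:Z <= Num.floor (alpha * (#|V|)%:R))%R.

Definition omega (R : realType) (gamma : R) (t : nat) : R :=
  (expR (- ((gamma * t%:R - t%:R + 1) / (gamma * t%:R)))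
   / (((t%:R - 1) / (gamma * t%:R)) `^ ((t%:R - 1) / (gamma * t%:R))))
  `^ (gamma * t%:R).

Definition logb (R : realType) (tau x : R) : R := ln x / ln tau.

Definition s1 (R : realType) (alpha : R) (t : nat) : R :=
  inf [set y : R | exists gamma tau : R,
        [/\ 1 <= gamma, 1 < tau, tau * omega gamma t < 1 &
         y = (gamma * tau / (tau - 1)) * (1 / (1 - omega gamma t * tau)) * (t%:R / alpha)
             + logb tau ((1 / (1 - omega gamma t * tau)) * (1 / alpha))]].

(* B ranges over positive naturals (B = 0 would make gamma*t/B meaningless). *)
Definition s2 (R : realType) (alpha : R) (t : nat) : R :=
  inf [set y : R | exists B : nat, (0 < B)%N /\ y = B%:R /\
        exists gamma : R, 1 <= gamma /\ gamma * t%:R / B%:R + omega gamma t <= alpha].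

Definition delta (R : realType) (t : nat) : R :=
  sup [set y : R | exists alpha : R, [/\ 0 < alpha, alpha <= 1 &
        y = Num.min (alpha * s1 alpha t / t%:R) (alpha * s2 alpha t / t%:R)]].

(* Main.v *)
(** By Scarf's lemma, applied to coalitions of voters who pay for a candidate,
    there is a fractional committee of size B in which, for every candidate a
    that is not fully elected, at most a fraction mu / B of the voters have less
    than mu units of candidates ranked weakly above a.  Pipage rounding with a
    Chernoff-type potential turns it into a committee of at most B candidates
    that leaves only a fraction omega of the voters without t members above
    their threshold; this is s2.  Repeating the construction on the voters left
    over, with committee sizes decreasing like a geometric series of ratio
    1 / tau, gives s1.  Both upper bounds on delta come from s1 alone: 4.75 with
    gamma = 7/2 and tau = e^2, and the limit with gamma = 1 + eta and
    tau = 1 / eta.  That delta > 1 is seen at alpha = 1. *)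

Require Import Defs.
From HB Require Import structures.
From mathcomp Require Import all_boot all_order all_algebra.
From mathcomp Require Import all_classical all_reals all_analysis.
From mathcomp Require Import ring lra zify.
From mathcomp Require Import fintype finset.
Set Implicit Arguments. Unset Strict Implicit. Unset Printing Implicit Defensive.
Import Order.TTheory GRing.Theory Num.Theory numFieldNormedType.Exports.
Local Open Scope ring_scope.

(** * Nonnegative solutions of linear systems *)

(** Two integrality losses shape the details. Committee sizes are rounded up at every stage, while
    [s1] reserves no separate term for this. When the tolerance passes from alpha to alpha * tau,
    the logarithm drops by exactly 1, which pays for every stage but the last. The last stage, where
    alpha * tau >= 1, has to fit into the first term alone; the estimates of [chernoff_tail] under a
    shift of mu serve this purpose. Voters are counted in integers too: coalitions get q = floor(mu
    n / B) + 1 members, so that mu n < q B is strict. The slack absorbs a perturbation of the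
    capacities, needed because the parity argument behind Scarf's lemma fails for degenerate
    systems. Candidates have capacity about 1, since rounding is certain to elect only those of
    fractional value 1; the guarantee for the others then covers every unelected candidate. *)

Lemma exists_dependency (R : fieldType) (T I : finType) (a : T -> I -> R)
    (M : {set T}) (N : {set I}) :
  (#|N| < #|M|)%N ->
  exists z : T -> R, [/\ exists j, z j != 0, forall j, j \notin M -> z j = 0 &
    forall i, i \in N -> \sum_j z j * a j i = 0].
Proof.
move=> NM; pose A := \matrix_(p < #|M|, q < #|N|) a (enum_val p) (enum_val q).
have : kermx A != 0.
  rewrite kermx_eq0 /row_free neq_ltn (leq_ltn_trans (rank_leq_col A)) //.
move=> /rowV0Pn [v /sub_kermxP vA v0].
pose z j := \sum_(p < #|M|) v 0 p * (enum_val p == j)%:R.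
have zE p : z (enum_val p) = v 0 p.
  rewrite /z (bigD1 p) //= eqxx mulr1 big1 ?addr0 // => p' pp'.
  by rewrite (inj_eq enum_val_inj) (negPf pp') mulr0.
exists z; split.
- have [p vp] : exists p, v 0 p != 0.
    apply: contrapT => /forallNP v00; move/eqP: v0; apply.
    by apply/rowP => p; rewrite mxE; have /negP := v00 p; rewrite negbK => /eqP.
  by exists (enum_val p); rewrite zE.
- move=> j jM; rewrite /z big1 // => p _; case: eqP => [pj|]; last by rewrite mulr0.
  by move: jM; rewrite -pj enum_valP.
- move=> i iN; rewrite /z.
  under eq_bigr do rewrite mulr_suml.
  rewrite exchange_big /=.
  have /matrixP /(_ 0 (enum_rank_in iN i)) := vA; rewrite !mxE => vAi.
  rewrite -[RHS]vAi; apply: eq_bigr => p _; rewrite mxE enum_rankK_in //.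
  rewrite (bigD1 (enum_val p)) //= eqxx mulr1 big1 ?addr0 // => j jp.
  by rewrite eq_sym (negPf jp) mulr0 mul0r.
Qed.

Lemma exists_nonroot (R : numFieldType) (p : {poly R}) (eta : R) :
  p != 0 -> 0 < eta -> exists e : R, [/\ 0 < e, e < eta & p.[e] != 0].
Proof.
move=> p0 eta0; apply: contrapT => H.
pose s := [seq eta / k.+2%:R | k <- iota 0 (size p)].
have s_uniq : uniq s.
  rewrite map_inj_uniq ?iota_uniq // => k l /(mulfI (lt0r_neq0 eta0)) /invr_inj.
  by move/eqP; rewrite eqr_nat => /eqP [].
have sroot : all (root p) s.
  apply/allP => _ /mapP [k _ ->]; apply/negPn/negP => pk; apply: H.
  exists (eta / k.+2%:R); split => //; first by rewrite divr_gt0.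
  by rewrite ltr_pdivrMr // ltr_pMr // ltr1n.
by have := max_poly_roots p0 sroot s_uniq; rewrite size_map size_iota ltnn.
Qed.

Definition nonneg_sol (R : numDomainType) (T I : finType) (a : T -> I -> R)
    (b : I -> R) (x : T -> R) : Prop :=
  (forall j, 0 <= x j) /\ forall i, \sum_j x j * a j i = b i.

Definition supp (R : nmodType) (T : finType) (x : T -> R) : {set T} :=
  [set j | x j != 0].

Definition nondegenerate (R : numDomainType) (T I : finType) (a : T -> I -> R)
    (b : I -> R) : Prop :=
  forall x, nonneg_sol a b x -> (#|I| <= #|supp x|)%N.

(* The perturbation follows the moment curve: the functional vanishing on
   fewer than #|I| columns becomes a nonzero polynomial in the parameter. *)
Lemma exists_nondegenerate (R : realFieldType) (T I : finType) (a : T -> I -> R)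
    (b0 : I -> R) (eta : R) : 0 < eta ->
  exists b : I -> R, (forall i, b0 i < b i < b0 i + eta) /\ nondegenerate a b.
Proof.
move=> eta0.
have H (D : {set T}) : exists l : I -> R, (#|D| < #|I|)%N ->
    (exists i, l i != 0) /\ forall j, j \in D -> \sum_i l i * a j i = 0.
  case: (ltnP #|D| #|I|) => DI; last by exists (fun=> 0).
  have [] := @exists_dependency R I T (fun i j => a j i) [set: I] D.
    by rewrite cardsT.
  by move=> l [l0 _ lD]; exists l.
have [l lP] : exists l : {set T} -> I -> R, forall D : {set T}, (#|D| < #|I|)%N ->
    (exists i, l D i != 0) /\ forall j, j \in D -> \sum_i l D i * a j i = 0.
  exact: fin_all_exists H.
(* The exponents start at 1, so the constant coming from [b0] cannot cancel the coefficient
   belonging to [i]. *)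
pose q (D : {set T}) : {poly R} := \sum_i l D i *: 'X^((enum_rank i).+1) + (\sum_i l D i * b0 i)%:P.
have qn0 (D : {set T}) : (#|D| < #|I|)%N -> q D != 0.
  move=> /lP [[i li0] _]; apply/eqP => /(congr1 (fun p : {poly R} => p`_((enum_rank i).+1))).
  rewrite coef0 coefD coefC /= addr0 coef_sum (bigD1 i) //= big1 ?addr0.
    by rewrite coefZ coefXn eqxx mulr1 => /eqP; apply/negP.
  move=> i' i'i; rewrite coefZ coefXn eqSS.
  case: eqP => [e|]; last by rewrite mulr0.
  by move: i'i; rewrite (enum_rank_inj (val_inj (esym e))) eqxx.
pose P := \prod_(D : {set T} | (#|D| < #|I|)%N) q D.
have P0 : P != 0 by rewrite prodf_seq_neq0; apply/allP => D _; apply/implyP/qn0.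
have m0 : 0 < Num.min eta 1 by rewrite lt_min eta0 ltr01.
have [e [e0 em Pe]] := exists_nonroot P0 m0.
move: em; rewrite lt_min => /andP [e_eta e1].
exists (fun i => b0 i + e ^+ (enum_rank i).+1); split.
  move=> i; rewrite ltrDl exprn_gt0 // ltrD2l (le_lt_trans _ e_eta) //.
  by rewrite exprS; apply: ler_piMr; [|apply: exprn_ile1]; apply: ltW.
move=> x [x0 xb]; rewrite leqNgt; apply/negP => sI.
have [_ ls] := lP _ sI.
have /negP := Pe; apply; rewrite horner_prod (bigD1 (supp x)) //= mulf_eq0.
apply/orP; left; apply/eqP.
rewrite hornerD hornerC horner_sum -big_split /=.
under eq_bigr => i _ do rewrite hornerZ hornerXn -mulrDr addrC -xb mulr_sumr.
rewrite exchange_big big1 //= => j _.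
have [xj0|xj0] := eqVneq (x j) 0.
  by rewrite big1 // => i _; rewrite xj0 mul0r mulr0.
under eq_bigr => i _ do rewrite mulrCA.
by rewrite -mulr_sumr ls ?mulr0 // inE.
Qed.

Section Bases.
Variables (R : realFieldType) (T I : finType) (a : T -> I -> R) (b : I -> R).
Hypothesis a_ge0 : forall j i, 0 <= a j i.
Hypothesis a_neq0 : forall j, exists i, a j i != 0.
Hypothesis b_nondeg : nondegenerate a b.

(** Vertices of the polytope of nonnegative solutions, identified by their supports; linear
    independence of the columns in [D] follows from nondegeneracy in [feasible_indep]. *)
Definition feasible_basis (D : {set T}) : Prop :=
  #|D| = #|I| /\ exists x, nonneg_sol a b x /\ supp x = D.

Let kernel (z : T -> R) := forall i, \sum_j z j * a j i = 0.

(** Nonnegative nonzero columns have no vanishing nontrivial combination with nonnegative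
    coefficients. This makes the ratio test stop. *)
Lemma kernel_has_neg z : kernel z -> (exists j, z j != 0) -> exists j, z j < 0.
Proof.
move=> kz [j zj]; apply: contrapT => /forallNP H.
have z0 j' : 0 <= z j' by rewrite leNgt; apply/negP/H.
have [i aij] := a_neq0 j.
have /eqP := kz i; rewrite psumr_eq0 => [/allP /(_ j (mem_index_enum _))|j' _].
  by rewrite /= mulf_eq0 (negPf zj) (negPf aij).
by rewrite mulr_ge0.
Qed.

Lemma ratio_test x z : nonneg_sol a b x -> kernel z -> (exists j, z j != 0) ->
  (forall j, x j = 0 -> 0 <= z j) ->
  exists s j, [/\ 0 < s, z j < 0, nonneg_sol a b (fun j => x j + s * z j) &
                 x j + s * z j = 0].
Proof.
move=> [x0 xb] kz zn0 zx.
have [j0 zj0] := kernel_has_neg kz zn0.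
have [j zj jmin] := @Order.TotalTheory.arg_minP _ R T j0 (fun j => z j < 0)
   (fun j => x j / - z j) zj0.
have xj : 0 < x j.
  by rewrite lt_neqAle x0 andbT eq_sym; apply/eqP => /zx; rewrite leNgt zj.
exists (x j / - z j), j; split => //.
- by rewrite divr_gt0 // oppr_gt0.
- split.
  + move=> j'; have [zj'|zj'] := ltP (z j') 0.
      have := jmin j' zj'; rewrite ler_pdivlMr ?oppr_gt0 //.
      by rewrite mulrN -subr_ge0 opprK addrC.
    by rewrite addr_ge0 // mulr_ge0 // divr_ge0 ?oppr_ge0 // ltW.
  + move=> i; under eq_bigr do rewrite mulrDl -mulrA.
    by rewrite big_split /= -mulr_sumr kz mulr0 addr0 xb.
- by rewrite invrN mulrN mulNr -mulrA mulVf ?mulr1 ?subrr // lt_eqF.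
Qed.

(** Moving along [z] stays inside the support of [x] and loses a coordinate, which nondegeneracy
    forbids. *)
Lemma feasible_indep x z : nonneg_sol a b x -> #|supp x| = #|I| ->
  kernel z -> (forall j, x j = 0 -> z j = 0) -> forall j, z j = 0.
Proof.
move=> sx cx kz zx j; apply/eqP/negPn/negP => zj.
have [s [j' [_ zj' sy yj']]] : exists s j, [/\ 0 < s, z j < 0,
    nonneg_sol a b (fun j => x j + s * z j) & x j + s * z j = 0].
  by apply: ratio_test => //; [exists j|move=> ? /zx ->].
have := b_nondeg sy; rewrite -cx leqNgt => /negP; apply.
apply: proper_card; apply/properP; split.
  apply/subsetP => i; rewrite !inE; apply: contraNN => /eqP xi.
  by rewrite xi zx // mulr0 addr0.
exists j'; last by rewrite inE yj' eqxx.
by rewrite inE; apply: contraTN zj' => /eqP /zx ->; rewrite ltxx.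
Qed.

(** The simplex pivot. Once one basis lies inside [M], the relations among its |I| + 1 columns form
    a line, so the solutions supported in [M] form a segment. By nondegeneracy only its two ends
    lose a column, one each. *)
Lemma feasible_sub_card (M : {set T}) : #|M| = #|I|.+1 ->
  #|[set D : {set T} | `[< feasible_basis D >] & D \subset M]| \in [:: 0; 2]%N.
Proof.
move=> cM; set F := [set D | _ & _].
have [->|[D DF]] := set_0Vmem F; first by rewrite cards0.
move: DF; rewrite inE => /andP [/asboolP [cD [x [sx xD]]] DM].
have [d dMD] : exists d, d \in M :\: D.
  by apply/card_gt0P; rewrite cardsD (setIidPr DM) cM cD subSnn.
have /setDP [dM dD] := dMD.
have MD : M :\ d = D.
  apply/esym/eqP; rewrite eqEcard subsetD1 DM dD /=.
  by have := cardsD1 d M; rewrite dM cM cD; lia.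
have xd0 : x d = 0 by apply/eqP/negPn; rewrite -xD inE negbK in dD *.
have [z' [z'n0 z'M z'k]] := @exists_dependency R T I a M [set: I] ltac:(by rewrite cardsT cM).
have indep y : kernel y -> (forall j, j \notin M -> y j = 0) -> y d = 0 ->
    forall j, y j = 0.
  move=> ky yM yd; apply: (feasible_indep sx) => //; first by rewrite xD.
  move=> j xj; have [->//|jd] := eqVneq j d; apply: yM; apply/negP => jM.
  have : j \in D by rewrite -MD !inE jd.
  by rewrite -xD inE xj eqxx.
have [z [zk zM zd]] : exists z, [/\ kernel z, forall j, j \notin M -> z j = 0 & 0 < z d].
  have kz' : kernel z' by move=> i; apply: z'k; rewrite inE.
  have : z' d != 0.
    apply/eqP => z'd; have [j] := z'n0.
    by rewrite (indep _ kz' z'M z'd) eqxx.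
  rewrite neq_lt => /orP [z'd|z'd]; last by exists z'.
  exists (fun j => - z' j); split; last by rewrite oppr_gt0.
    by move=> i; under eq_bigr do rewrite mulNr; rewrite sumrN kz' oppr0.
  by move=> j /z'M ->; rewrite oppr0.
have outM y : supp y \subset M -> forall j, j \notin M -> y j = 0.
  move=> yM j; apply: contraNeq => yj; apply: (subsetP yM); by rewrite inE.
have xM : forall j, j \notin M -> x j = 0 by apply: outM; rewrite xD.
have [s [d' [s0 zd' sy yd']]] : exists s j, [/\ 0 < s, z j < 0,
    nonneg_sol a b (fun j => x j + s * z j) & x j + s * z j = 0].
  apply: ratio_test => //; first by exists d; rewrite gt_eqF.
  move=> j xj; have [->|jd] := eqVneq j d; first exact: ltW.
  rewrite zM //; apply/negP => jM.
  have : j \in D by rewrite -MD !inE jd.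
  by rewrite -xD inE xj eqxx.
set y := fun j => _ in sy.
have d'M : d' \in M by apply: contraTT zd' => /zM ->; rewrite ltxx.
have ysub : supp y \subset M :\ d'.
  apply/subsetP => j; rewrite !inE; apply: contraNT => /nandP [|jM].
    by rewrite negbK => /eqP ->; rewrite /y yd'.
  by rewrite /y xM // zM // mulr0 addr0.
have cM' e : e \in M -> #|M :\ e| = #|I| by have := cardsD1 e M; case: (e \in M) => // + _; lia.
have yM : supp y = M :\ d'.
  by apply/eqP; rewrite eqEcard ysub cM' // b_nondeg.
have dd' : d != d' by apply: contraTneq zd' => <-; rewrite -leNgt ltW.
suff -> : F = [set D; M :\ d'].
  rewrite cards2 -MD; case: eqP => [e|] //; move: (setD11 d M).
  by rewrite e !inE dd' dM.
apply/setP => D''; rewrite !inE; apply/andP/orP; last first.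
  move=> [/eqP->|/eqP->]; first by split => //; apply/asboolP; split => //; exists x.
  split; last exact: subsetDl.
  by apply/asboolP; split; [exact: cM'|exists y].
move=> [/asboolP [cD'' [x'' [sx'' x''D]]] D''M].
have [->|nD] := eqVneq D'' D; [by left|right].
have [d'' dMD''] : exists d, d \in M :\: D''.
  by apply/card_gt0P; rewrite cardsD (setIidPr D''M) cM cD'' subSnn.
have /setDP [d''M d''D] := dMD''.
have MD'' : M :\ d'' = D''.
  by apply/esym/eqP; rewrite eqEcard subsetD1 D''M d''D cM' //= cD''.
have x''M : forall j, j \notin M -> x'' j = 0 by apply: outM; rewrite x''D.
have x''d : x'' d'' = 0 by apply/eqP/negPn; rewrite -x''D inE negbK in d''D *.
have dd'' : d != d'' by apply: contra_neq nD => e; rewrite -MD'' -MD e.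
pose s'' := x'' d / z d.
have x''E j : x'' j = x j + s'' * z j.
  have /(_ j) : forall j, x'' j - x j - s'' * z j = 0.
    apply: indep.
    - move=> i; under eq_bigr do rewrite !mulrBl -mulrA.
      by rewrite !sumrB -mulr_sumr zk mulr0 subr0 sx''.2 sx.2 subrr.
    - by move=> j' jM; rewrite xM // zM // x''M // mulr0 !subr0.
    - by rewrite xd0 subr0 /s'' divfK ?subrr // gt_eqF.
  by move=> H; lra.
(* Past the step at which a coordinate vanishes it turns negative, so two boundary steps along [z]
   cannot differ. *)
have neg_at e w u : e \in M -> e != d -> 0 < u -> x e + u * z e = 0 -> u < w ->
    x e + w * z e < 0.
  move=> eM ed u0 e0 uw.
  have xe : 0 < x e.
    rewrite lt_neqAle sx.1 andbT eq_sym.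
    have : e \in D by rewrite -MD !inE ed.
    by rewrite -xD inE.
  have ze : z e < 0 by rewrite ltNge; apply/negP => ze; have := mulr_ge0 (ltW u0) ze; lra.
  by have := ltr_nM2r ze w u; rewrite uw; lra.
have s''0 : 0 < s''.
  rewrite divr_gt0 // lt_neqAle sx''.1 andbT eq_sym.
  have : d \in D'' by rewrite -MD'' !inE dd''.
  by rewrite -x''D inE.
have [ss|ss|ss] := ltgtP s s''.
- have := neg_at d' s'' s d'M; rewrite eq_sym dd' => /(_ isT s0 yd' ss).
  by rewrite -x''E ltNge sx''.1.
- have := neg_at d'' s s'' d''M; rewrite eq_sym dd'' -x''E => /(_ isT s''0 x''d ss).
  by have := sy.1 d''; rewrite /y leNgt => /negPf ->.
apply/eqP; rewrite -yM -x''D /supp.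
by apply/setP => j; rewrite !inE x''E /y ss.
Qed.

End Bases.

(** * Scarf's lemma *)

Definition dominating (T I : finType) (c : I -> T -> nat) (J : {set T}) : bool :=
  [forall k, exists i, forall j in J, (c i k <= c i j)%N].

Lemma dominatingP (T I : finType) (c : I -> T -> nat) (J : {set T}) :
  reflect (forall k, exists i, forall j, j \in J -> (c i k <= c i j)%N) (dominating c J).
Proof.
apply: (iffP forallP) => H k.
  by have /existsP [i /forall_inP ci] := H k; exists i.
by have [i ci] := H k; apply/existsP; exists i; apply/forall_inP.
Qed.

Section Ordinal.
Variables (I E : finType).
Local Notation T := (I + E)%type.
Variable c : I -> T -> nat.
Hypothesis c_inj : forall i, injective (c i).
Hypothesis c_own : forall i j, (c i (inl i) <= c i j)%N.
Hypothesis c_other : forall i k e, k != i -> (c i (inr e) < c i (inl k))%N.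

Let extensions (K : {set T}) : {set {set T}} :=
  [set J : {set T} | dominating c J & (#|J| == #|I|) && (K \subset J)].

Lemma extension_split (K J : {set T}) : #|K|.+1 = #|I| -> #|J| = #|I| -> K \subset J ->
  exists2 j, j \notin K & J = j |: K.
Proof.
move=> cK cJ KJ; have [j] : exists j, j \in J :\: K.
  by apply/card_gt0P; rewrite cardsD (setIidPr KJ) cJ -cK subSnn.
move=> /setDP [jJ jK]; exists j => //; apply/esym/eqP.
by rewrite eqEcard subUset sub1set jJ KJ cardsU1 jK add1n cK cJ /=.
Qed.

(** In a row other than [i0] the own slack lies in [K] and is the minimum. Columns outside [K] can
    thus be dominated through row [i0] only, which forces the added column to be the largest of them
    there. *)
Lemma card_extensions_slack (i0 : I) :
  #|extensions [set inl i | i in [set~ i0]]| = 1%N.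
Proof.
set K := [set _ | _ in _].
have KP k : k \in K -> exists2 i, i != i0 & k = inl i.
  by move=> /imsetP [i]; rewrite !inE => ii0 ->; exists i.
have i0K : inl i0 \notin K by apply/negP => /KP [i /eqP ii0 [/esym]].
have inK i : i != i0 -> inl i \in K by move=> ii0; apply: imset_f; rewrite !inE.
have cK : #|K|.+1 = #|I|.
  rewrite card_imset; last by move=> ? ? [].
  by rewrite cardsC1; have := max_card (pred1 i0); rewrite card1; lia.
have [j jK jmax] : exists2 j, j \notin K & forall k, k \notin K -> (c i0 k <= c i0 j)%N.
  by have [j jK jm] := @arg_maxnP _ (inl i0) (fun k => k \notin K) (c i0) i0K; exists j.
suff -> : extensions K = [set j |: K] by rewrite cards1.
apply/setP => J; rewrite !inE; apply/and3P/eqP.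
  move=> [/dominatingP dJ /eqP cJ KJ].
  have [j' j'K eJ] := extension_split cK cJ KJ; rewrite eJ; congr (_ |: _).
  have [i ci] := dJ j.
  have ii0 : i = i0.
    apply/eqP/negPn/negP => ii0; have := ci (inl i) (subsetP KJ _ (inK _ ii0)).
    have := c_own i j => c1 c2; have e : c i (inl i) = c i j by lia.
    by move: jK; rewrite -(c_inj e) inK.
  apply: (c_inj (i := i0)); apply/eqP; rewrite eqn_leq jmax //= -{1}ii0 -ii0 ci //.
  by rewrite eJ setU11.
move=> ->; split; last exact: subsetUr.
  apply/dominatingP => k; have [kK|kK] := boolP (k \in K).
    by have [i _ ->] := KP _ kK; exists i.
  exists i0 => j' /setU1P [->|/KP [i ii0 ->]]; first exact: jmax.
  case: k kK => [k|e _]; last by rewrite ltnW // c_other.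
  by have [->|/inK ->] := eqVneq k i0.
by rewrite cardsU1 jK add1n cK.
Qed.

(** The ordinal pivot. Sending each row to its least element of [K] maps [I] onto [K], which is one
    element smaller, so exactly two rows collide. An added column must take over the minimum of one
    of these two rows, and each choice admits exactly one column. *)
Lemma card_extensions (K : {set T}) (e : E) : #|K|.+1 = #|I| -> inr e \in K ->
  #|extensions K| \in [:: 0; 2]%N.
Proof.
move=> cK eK; have [->|[J0]] := set_0Vmem (extensions K); first by rewrite cards0.
rewrite inE => /and3P [dJ0 /eqP cJ0 KJ0].
have dK : forall k, exists i, forall j, j \in K -> (c i k <= c i j)%N.
  move=> k; have /dominatingP /(_ k) [i ci] := dJ0; exists i => j jK.
  by apply: ci; apply: (subsetP KJ0).
have fex i : exists k, k \in K /\ forall j, j \in K -> (c i k <= c i j)%N.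
  by have [j jK jm] := @arg_minnP _ (inr e) (fun k => k \in K) (c i) eK; exists j.
have [f fP] := fin_all_exists fex.
have fK i : f i \in K by have [] := fP i.
have fmin i j : j \in K -> (c i (f i) <= c i j)%N by have [_] := fP i; apply.
have fE i k : k \in K -> (forall j, j \in K -> (c i k <= c i j)%N) -> f i = k.
  by move=> kK km; apply: (c_inj (i := i)); apply/eqP; rewrite eqn_leq fmin // km.
have fsurj k : k \in K -> exists i, f i = k.
  by move=> kK; have [i ci] := dK k; exists i; apply: fE.
have [i0 [i1 [i01 fi01]]] : exists i0 i1, i0 != i1 /\ f i0 = f i1.
  apply: contrapT => H.
  have finj : injective f.
    by move=> i i' ff; apply/eqP/negPn/negP => ii; apply: H; exists i, i'.
  have : #|f @: [set: I]| = #|I| by rewrite card_imset // cardsT.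
  have : (#|f @: [set: I]| <= #|K|)%N.
    by apply/subset_leq_card/subsetP => _ /imsetP [i _ ->].
  by lia.
(* Removing either of the colliding rows leaves a bijection onto K. *)
have inj_off r : r \in [:: i0; i1] -> {in [set~ r] &, injective f}.
  move=> ri; apply/imset_injP; rewrite cardsC1.
  have -> : #|I|.-1 = #|K| by rewrite -cK.
  rewrite eqn_leq; apply/andP; split.
    by apply/subset_leq_card/subsetP => _ /imsetP [i _ ->].
  apply/subset_leq_card/subsetP => k /fsurj [i <-].
  have [->|ir] := eqVneq i r; last by apply: imset_f; rewrite !inE.
  move: ri; rewrite !inE => /orP [] /eqP ->; [rewrite fi01|rewrite -fi01];
    by apply: imset_f; rewrite !inE // eq_sym.
have collision i i' : i != i' -> f i = f i' -> i \in [:: i0; i1].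
  move=> ii' ff; have [->|ii0] := eqVneq i i0; first by rewrite inE eqxx.
  have [->|ii1] := eqVneq i i1; first by rewrite !inE eqxx orbT.
  have [e0|n0] := eqVneq i' i0.
    have := inj_off i1 _ i i'; rewrite !inE eqxx orbT ii1 e0 i01 => /(_ isT isT isT).
    by rewrite -e0 => /(_ ff) /eqP; rewrite (negPf ii').
  have := inj_off i0 _ i i'; rewrite !inE eqxx ii0 n0 => /(_ isT isT isT ff) /eqP.
  by rewrite (negPf ii').
(* [M r] holds the columns that [K] does not dominate through rows other than [r]. The added column
   lies in it and, to dominate the rest of it through row [r], must be the largest there. *)
pose M r := [set k | [forall i, (i != r) ==> (c i (f i) < c i k)%N]].
have MP r k : k \in M r -> forall i, i != r -> (c i (f i) < c i k)%N.
  by rewrite inE => /forallP H i ir; have := H i; rewrite ir.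
have Mr r : inl r \in M r.
  rewrite inE; apply/forallP => i; apply/implyP => ir.
  by rewrite (leq_ltn_trans (fmin i _ eK)) // c_other // eq_sym.
have mex r : exists j, j \in M r /\ forall k, k \in M r -> (c r k <= c r j)%N.
  by have [j jK jm] := @arg_maxnP _ (inl r) (fun k => k \in M r) (c r) (Mr r); exists j.
have [m mP] := fin_all_exists mex.
have mM r : m r \in M r by have [] := mP r.
have mmax r k : k \in M r -> (c r k <= c r (m r))%N by have [_] := mP r; apply.
(* [K] dominates [m r], and no row other than [r] can witness it. *)
have mlow r : (c r (m r) <= c r (f r))%N.
  have [i ci] := dK (m r); have [ir|ir] := eqVneq i r; first by rewrite ir in ci; apply: ci.
  by have := ci _ (fK i); rewrite leqNgt (MP r).
have mK r : r \in [:: i0; i1] -> m r \notin K.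
  move=> ri; apply/negP => /fsurj [i fi].
  have [ir|ir] := eqVneq i r; last by have := MP _ _ (mM r) i ir; rewrite fi ltnn.
  have [i' i'r fi'] : exists2 i', i' != r & f i' = f r.
    move: ri; rewrite !inE => /orP [] /eqP ->; last by exists i0.
    by exists i1; rewrite // eq_sym.
  by have := MP _ _ (mM r) i' i'r; rewrite -fi ir fi' ltnn.
have m01 : m i0 != m i1.
  apply/eqP => mm; have [i ci] := dK (m i0); have := ci _ (fK i); rewrite leqNgt => /negP; apply.
  have [->|n0] := eqVneq i i0; last exact: (MP i0).
  by rewrite mm; apply: (MP i1).
suff -> : extensions K = [set m i0 |: K; m i1 |: K].
  rewrite cards2; case: eqP => // /setP /(_ (m i0)).
  by rewrite !inE eqxx (negPf m01) (negPf (mK i0 _)) // inE eqxx.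
apply/setP => J; rewrite !inE; apply/and3P/orP.
  move=> [/dominatingP dJ /eqP cJ KJ].
  have [j jK eJ] := extension_split cK cJ KJ.
  have jJ : j \in J by rewrite eJ setU11.
  have [r cr] := dJ j.
  have row k : k \in K -> exists2 i, i != r & f i = k /\ (c i k < c i j)%N.
    move=> kK; have kJ := subsetP KJ _ kK.
    have kj : k != j by apply: contraNneq jK => <-.
    have [i ci] := dJ k; exists i.
      apply: contraNneq kj => ir; apply/eqP/(c_inj (i := r))/eqP.
      by rewrite eqn_leq cr // -ir ci.
    split; first by apply: fE => // j' j'K; apply/ci/(subsetP KJ).
    rewrite ltn_neqAle ci // andbT; apply: contra_neq kj; exact: c_inj.
  have r01 : r \in [:: i0; i1].
    by have [i ir [fi _]] := row _ (fK r); apply: (collision r i) => //; rewrite eq_sym.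
  have jM : j \in M r.
    rewrite inE; apply/forallP => i; apply/implyP => ir.
    have [i' i'r [fi' ci']] := row _ (fK i).
    have ii' : i = i' by apply: (inj_off r) => //; rewrite !inE.
    by move: ci'; rewrite -ii'.
  have jm : j = m r.
    apply: (c_inj (i := r)); apply/eqP; rewrite eqn_leq mmax //=.
    have [i ci] := dJ (m r); have [ir|ir] := eqVneq i r; first by rewrite ir in ci; apply: ci.
    by have := ci _ (subsetP KJ _ (fK i)); rewrite leqNgt (MP r).
  by rewrite eJ jm; move: r01; rewrite !inE => /orP [] /eqP ->; [left|right].
suff main r : r \in [:: i0; i1] ->
    [/\ dominating c (m r |: K), #|m r |: K| == #|I| & K \subset m r |: K].
  by move=> [] /eqP ->; apply: main; rewrite !inE eqxx ?orbT.
move=> ri; split; [|by rewrite cardsU1 mK // add1n cK|exact: subsetUr].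
apply/dominatingP => k; have [kM|] := boolP (k \in M r).
  exists r => j /setU1P [->|jK]; first exact: mmax.
  by apply: leq_trans (mmax _ _ kM) (leq_trans (mlow r) (fmin _ _ jK)).
rewrite inE negb_forall => /existsP [i]; rewrite negb_imply -leqNgt => /andP [ir cik].
exists i => j /setU1P [->|jK]; last exact: leq_trans cik (fmin _ _ jK).
by apply: leq_trans cik (ltnW (MP _ _ (mM r) i ir)).
Qed.

Variables (R : realFieldType) (a : T -> I -> R) (b : I -> R).
Hypothesis a_ge0 : forall j i, 0 <= a j i.
Hypothesis a_neq0 : forall j, exists i, a j i != 0.
Hypothesis a_slack : forall k i, a (inl k) i = (k == i)%:R.
Hypothesis b_gt0 : forall i, 0 < b i.
Hypothesis b_nondeg : nondegenerate a b.

Local Notation feasible := (feasible_basis a b).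

Lemma feasible_slack : feasible [set inl i | i in [set: I]].
Proof.
split; first by rewrite card_imset ?cardsT // => ? ? [].
exists (fun j => if j is inl i then b i else 0); split.
  split => [[i|//]|i]; first exact: ltW.
  rewrite big_sumType /= [X in _ + X]big1 ?addr0 => [|e _]; last by rewrite mul0r.
  rewrite (bigD1 i) //= a_slack eqxx mulr1 big1 ?addr0 // => k /negPf ki.
  by rewrite a_slack ki mulr0.
apply/setP => -[i|e]; rewrite !inE.
  by rewrite gt_eqF //; apply/esym/imset_f; rewrite inE.
by rewrite eqxx; apply/esym/negbTE/negP => /imsetP [].
Qed.

(* Scarf's lemma.  Double count, modulo 2, the pairs (D, J) with D a feasible
   basis containing the slack column of i0 and J a dominating set containing
   the other columns of D. *)
Lemma scarf (i0 : I) : exists J : {set T}, [/\ #|J| = #|I|, dominating c J & feasible J].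
Proof.
apply: contrapT => noJ.
pose s0 : T := inl i0.
pose D0 : {set T} := [set inl i | i in [set: I]].
pose FB := [set D : {set T} | `[< feasible D >] & s0 \in D].
pose DS := [set J : {set T} | dominating c J & #|J| == #|I|].
pose N := (\sum_(D in FB) \sum_(J in DS) (D :\ s0 \subset J : nat))%N.
(* Summed over [J] first: a basis other than [D0] has a non-slack column, hence an even number of
   extensions, while [D0] has exactly one. *)
have oddN : odd N.
  have oddS (D : {set T}) : D \in FB -> D != D0 -> ~~ odd (\sum_(J in DS) (D :\ s0 \subset J : nat))%N.
    rewrite inE => /andP [/asboolP [cD [x [sx xD]]] s0D] DD0.
    have [e eD] : exists e, inr e \in D.
      apply: contrapT => /forallNP H; move/eqP: DD0; apply; apply/eqP.
      rewrite eqEcard card_imset ?cardsT ?cD ?leqnn ?andbT; last by move=> ? ? [].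
      by apply/subsetP => -[i _|e /H//]; apply: imset_f.
    have cK : #|D :\ s0|.+1 = #|I| by rewrite -cD (cardsD1 s0 D) s0D.
    have eK : inr e \in D :\ s0 by rewrite !inE.
    have := card_extensions cK eK; rewrite -sum1_card.
    rewrite -big_mkcondr /= [X in X \in _](_ : _ = \sum_(J in DS | D :\ s0 \subset J) 1)%N.
      by rewrite !inE => /orP [] /eqP ->.
    by apply: eq_bigl => J; rewrite !inE andbA.
  have D0F : D0 \in FB.
    by rewrite inE; apply/andP; split; [apply/asboolP/feasible_slack|apply: imset_f].
  rewrite /N (bigD1 D0) //= oddD; set X := (X in _ (+) odd X).
  have -> : odd X = false.
    rewrite /X; elim/big_ind: _ => // [x y|D /andP [DF DD0]]; first by rewrite oddD => -> ->.
    by apply/negbTE/oddS.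
  rewrite addbF; have := card_extensions_slack i0; rewrite -sum1_card.
  rewrite -big_mkcondr /= [X in X = _](_ : _ = \sum_(J in DS | D0 :\ s0 \subset J) 1)%N => [->//|].
  have -> : D0 :\ s0 = [set inl i | i in [set~ i0]].
    apply/setP => -[i|e]; rewrite !inE.
      apply/andP/imsetP => [[ii0 _]|[i']].
        by exists i => //; rewrite !inE; apply: contra_neq ii0 => ->.
      rewrite !inE => i'i0 [->]; split; last by apply: imset_f.
      by apply: contra_neq i'i0 => -[].
    by apply/idP/idP => [|] /imsetP [].
  by apply: eq_bigl => J; rewrite !inE andbA.
(* Summed over [D] first: if [s0] is in [J], a counted [D] would equal [J]. Otherwise the counted
   [D] are the feasible bases inside [s0 |: J], zero or two of them; one that misses [s0] would
   again be [J]. *)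
move: oddN; rewrite /N exchange_big /=; apply/negP.
elim/big_ind: _ => // [x y|J]; first by rewrite oddD => /negPf -> /negPf ->.
rewrite inE => /andP [dJ /eqP cJ].
have nfJ : ~ feasible J by move=> fJ; apply: noJ; exists J.
rewrite -big_mkcondr /= sum1dep_card.
have [s0J|s0J] := boolP (s0 \in J).
  rewrite eq_card0 // => D; rewrite !inE; apply/negbTE/negP => /andP [/andP [/asboolP fD s0D] DJ].
  apply: nfJ; suff <- : D = J by [].
  apply/eqP; rewrite eqEcard cJ fD.1 leqnn andbT; apply/subsetP => j jD.
  by have [->//|js] := eqVneq j s0; apply: (subsetP DJ); rewrite !inE js.
have cM : #|s0 |: J| = #|I|.+1 by rewrite cardsU1 s0J cJ.
have := feasible_sub_card a_ge0 a_neq0 b_nondeg cM.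
rewrite [X in X \in _](_ : _ = #|[set D | (D \in FB) && (D :\ s0 \subset J)]|).
  by rewrite !inE => /orP [] /eqP ->.
apply: eq_card => D; rewrite !inE; apply/andP/andP => [[/asboolP fD DM]|[/andP [fD s0D] DJ]].
  have s0D : s0 \in D.
    apply/negPn/negP => s0D; apply: nfJ; suff <- : D = J by [].
    apply/eqP; rewrite eqEcard cJ fD.1 leqnn andbT; apply/subsetP => j jD.
    by have := subsetP DM _ jD; rewrite !inE => /orP [/eqP js|//]; rewrite js (negPf s0D) in jD.
  split; first by rewrite s0D andbT; apply/asboolP.
  apply/subsetP => j; rewrite !inE => /andP [js jD].
  by have := subsetP DM _ jD; rewrite !inE (negPf js).
split => //; apply/subsetP => j jD; rewrite !inE.
by have [//|js] := eqVneq j s0; apply: (subsetP DJ); rewrite !inE js.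
Qed.

End Ordinal.

(** * Fractional committees *)

Definition incidence (R : pzSemiRingType) (I E : finType) (inc : E -> {set I})
    (j : I + E) (i : I) : R :=
  match j with inl k => (k == i)%:R | inr e => (i \in inc e)%:R end.

Lemma fractional_stable_matching (R : realFieldType) (I E : finType) (i0 : I)
    (inc : E -> {set I}) (u : I -> E -> nat) (b : I -> R) :
  (forall e, inc e != set0) -> (forall i, injective (u i)) -> (forall i, 0 < b i) ->
  nondegenerate (incidence R inc) b ->
  exists y : E -> R, [/\ forall e, 0 <= y e,
    forall i, \sum_(e | i \in inc e) y e <= b i &
    forall e, exists2 i, i \in inc e &
      \sum_(e' | (i \in inc e') && (u i e <= u i e')%N) y e' = b i].
Proof.
move=> inc0 u_inj b0 bnd.
pose m i := \max_e u i e.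
have um i e : (u i e <= m i)%N by apply: leq_bigmax.
(* Increasing order in row [i]: its own slack, the edges containing [i] sorted by [u i], the edges
   avoiding [i], the other slacks. *)
pose c i (j : I + E) : nat := match j with
  | inl k => if k == i then 0 else (2 * (m i).+1 + (enum_rank k).+1)%N
  | inr e => ((i \notin inc e) * (m i).+1 + (u i e).+1)%N end.
have c_inj i : injective (c i).
  move=> [k|e] [k'|e'] /=.
  - case: eqP => [->|_]; case: eqP => [->|_] h //; try lia.
    by congr inl; apply/enum_rank_inj/val_inj => /=; lia.
  - by have := um i e'; case: eqP; case: (i \notin _) => /=; lia.
  - by have := um i e; case: eqP; case: (i \notin _) => /=; lia.
  - have := um i e; have := um i e' => h1 h2 h.
    by congr inr; apply: (u_inj i); move: h; case: (i \notin _); case: (i \notin _) => /=; lia.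
have c_own i j : (c i (inl i) <= c i j)%N by rewrite /c eqxx.
have c_other i k e : k != i -> (c i (inr e) < c i (inl k))%N.
  by move=> /negPf /= ->; have := um i e; case: (i \notin _) => /=; lia.
have a_ge0 j i : 0 <= incidence R inc j i by case: j => ?; rewrite ler0n.
have a_neq0 j : exists i, incidence R inc j i != 0.
  case: j => [k|e]; first by exists k; rewrite /= eqxx oner_eq0.
  by have /set0Pn [i ie] := inc0 e; exists i; rewrite /= ie oner_eq0.
have [J [_ /dominatingP dJ [_ [x [[x0 xb] xJ]]]]] :=
  scarf c_inj c_own c_other a_ge0 a_neq0 (fun _ _ => erefl) b0 bnd i0.
have xout j : j \notin J -> x j = 0 by rewrite -xJ inE negbK => /eqP.
have rowE i : b i = x (inl i) + \sum_(e | i \in inc e) x (inr e).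
  rewrite -xb big_sumType /= (bigD1 i) //= eqxx mulr1 big1 ?addr0 => [|k /negPf ->]; last by rewrite mulr0.
  rewrite [in RHS]big_mkcond /=; congr (_ + _); apply: eq_bigr => e _.
  by case: (i \in inc e); rewrite ?mulr1 ?mulr0.
exists (fun e => x (inr e)); split => //; first by move=> i; rewrite rowE lerDr.
(* Whatever ranks below [e] in row [i] is outside [J] and has value 0. This removes the slack, so
   the capacity is tight; and were [i] not in [e], it would remove all edges containing [i], against
   [b i > 0]. *)
move=> e; have [i ci] := dJ (inr e).
have slack : x (inl i) = 0.
  apply: xout; apply/negP => /ci /=; rewrite eqxx; lia.
have ie : i \in inc e.
  apply/negPn/negP => ie; have := b0 i; rewrite rowE slack add0r big1 ?ltxx // => e' ie'.
  apply: xout; apply/negP => /ci /=; rewrite ie ie' /=; have := um i e'; lia.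
exists i => //; rewrite rowE slack add0r [RHS](bigID (fun e' => (u i e <= u i e')%N)) /=.
rewrite [X in _ + X]big1 ?addr0 // => e' /andP [ie' ue].
by apply: xout; apply/negP => /ci /=; rewrite ie ie' /= ; lia.
Qed.

Definition weak_upper (A : finType) (r : rel A) (a : A) : {set A} :=
  [set c | (c == a) || r c a].

Lemma exists_subset_card (T : finType) (B : {set T}) q : (q <= #|B|)%N ->
  exists S : {set T}, S \subset B /\ #|S| = q.
Proof.
move=> qB; exists [set x in take q (enum B)]; split.
  by apply/subsetP => x; rewrite inE => /mem_take; rewrite mem_enum.
have /card_uniqP : uniq (take q (enum B)) by rewrite take_uniq ?enum_uniq.
by rewrite cardsE size_take -cardE => ->; case: ltngtP qB.
Qed.

Section Fractional.
Variables (R : realFieldType) (V A : finType) (pref : V -> rel A).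
Hypothesis pref_irr : forall v, irreflexive (pref v).
Hypothesis pref_trans : forall v, transitive (pref v).
Hypothesis pref_total : forall v x y, x != y -> pref v x y || pref v y x.

(* A coalition edge (a, S) pays one unit of a; every member of S, and a itself,
   has bounded capacity.  Stability of a fractional matching of these edges
   means that no coalition of q voters can agree on more of a. *)
Lemma exists_fractional_committee (V' : {set V}) (mu : R) (q B : nat) :
  0 < mu -> (0 < q)%N -> mu * #|V'|%:R < q%:R * B%:R ->
  exists x : A -> R, [/\ forall a, 0 <= x a <= 1, \sum_a x a <= B%:R &
    forall a, x a < 1 ->
      (#|[set v in V' | (\sum_(c in weak_upper (pref v) a) x c < mu)%R]| < q)%N].
Proof.
move=> mu0 q0 muq.
have [|[i0]] := set_0Vmem [set: A].
  move=> A0; exists (fun=> 0); split; first by move=> a; rewrite lexx ler01.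
    by rewrite big1.
  by move=> a; have : a \in [set: A] by []; rewrite A0 inE.
move=> _.
pose E := {p : A * {set V} | (p.2 \subset V') && (#|p.2| == q)}.
pose inc (e : E) : {set V + A} := [set inl v | v in (val e).2] :|: [set inr (val e).1].
have inl_inc v e : (inl v \in inc e) = (v \in (val e).2).
  by rewrite !inE orbF mem_imset // => ? ? [].
have inr_inc a e : (inr a \in inc e) = (a == (val e).1).
  rewrite !inE; case: imsetP => [[]//|_] /=.
  by apply/eqP/eqP => [[]|->].
pose rk v a := #|[set c | pref v a c]|.
have rk_le v a a' : (rk v a <= rk v a')%N -> a' \in weak_upper (pref v) a.
  move=> rkaa; rewrite inE; have [//|aa'] := eqVneq a' a; apply/negPn/negP => npa /=.
  have /orP [paa|] := pref_total v aa'; first by rewrite paa in npa.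
  move=> paa; move: rkaa; rewrite leqNgt => /negP; apply.
  apply: proper_card; apply/properP; split.
    by apply/subsetP => c; rewrite !inE; apply: pref_trans.
  by exists a'; rewrite inE // pref_irr.
have [N rank_lt] : exists N, forall e : E, (enum_rank e < N)%N.
  by exists #|{: E}| => e; apply: ltn_ord.
(* Larger is better. Voters are indifferent between edges with the same candidate, and the
   enumeration breaks these ties. For candidates any injective order will do, as only saturation of
   their capacity is used. *)
pose u (i : V + A) (e : E) : nat := match i with
  | inl v => (rk v (val e).1 * N + enum_rank e)%N
  | inr a => enum_rank e end.
have u_inj i : injective (u i).
  move=> e e'; case: i => [v|a] /= h; apply/enum_rank_inj/val_inj => //=.
  by have := congr1 (modn^~ N) h; rewrite !modnMDl !modn_small.
have u_rk v e e' : (u (inl v) e <= u (inl v) e')%N -> (rk v (val e).1 <= rk v (val e').1)%N.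
  rewrite /u => h; have l := rank_lt e'.
  rewrite leqNgt; apply/negP => l2.
  have : ((rk v (val e').1).+1 * N <= rk v (val e).1 * N)%N.
    by rewrite leq_mul2r l2 orbT.
  by rewrite mulSn leqNgt => /negP; apply; move: h l; clear; lia.
pose n : R := #|V'|%:R.
pose K : R := #|A|%:R.
have n0 : 0 <= n by rewrite ler0n.
have K0 : 0 <= K by rewrite ler0n.
(* Truncation at 1 costs up to [eta] for each of the [K] candidates, and the perturbation adds up to
   [eta] per voter; this [eta] keeps the total load n (mu + (K + 1) eta) within q B. *)
pose eta := (q%:R * B%:R - mu * n) / (n * (K + 1) + 1).
have den : 0 < n * (K + 1) + 1 by rewrite ltr_wpDl // mulr_ge0 // addr_ge0.
have eta0 : 0 < eta by rewrite divr_gt0 // subr_gt0.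
have etaE : eta * (n * (K + 1) + 1) = q%:R * B%:R - mu * n by rewrite divfK // gt_eqF.
pose b0 (i : V + A) : R := match i with inl v => mu + K * eta | inr a => 1 end.
have [b [bb bnd]] := exists_nondegenerate (incidence R inc) b0 eta0.
have b_gt0 i : 0 < b i.
  have /andP [+ _] := bb i; apply: le_lt_trans; case: i => [v|a] /=; last exact: ler01.
  by apply: addr_ge0; [|apply: mulr_ge0 => //]; apply: ltW.
have inc0 e : inc e != set0.
  by apply/set0Pn; exists (inr (val e).1); rewrite inr_inc.
have [y [y0 yb ystable]] := fractional_stable_matching (inr i0) inc0 u_inj b_gt0 bnd.
pose X a := \sum_(e | a == (val e).1) y e.
have X0 a : 0 <= X a by apply: sumr_ge0.
have Xb a : X a <= b (inr a).
  by have := yb (inr a); under eq_bigl do rewrite inr_inc.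
pose x a := Num.min 1 (X a).
have xX a : X a <= x a + eta.
  rewrite /x; case: (leP 1 (X a)) => X1; last by lra.
  by have /andP [_ /ltW] := bb (inr a); apply: le_trans; apply: Xb.
exists x; split.
- by move=> a; rewrite le_min ler01 X0 ge_min lexx.
- apply: (@le_trans _ _ (\sum_a X a)); first by apply: ler_sum => a _; rewrite ge_min lexx orbT.
  have -> : \sum_a X a = \sum_e y e.
    rewrite /X (exchange_big_dep xpredT) //=; apply: eq_bigr => e _.
    by rewrite (big_pred1 (val e).1).
  have q0' : 0 < q%:R :> R by rewrite ltr0n.
  rewrite -(ler_pM2l q0') mulr_sumr.
  (* Each edge is charged to its [q] voters, whose capacities bound the total. *)
  have -> : \sum_e q%:R * y e = \sum_(v in V') \sum_(e | inl v \in inc e) y e.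
    under [RHS]eq_bigr => v vV do under eq_bigl => e do rewrite inl_inc.
    rewrite (exchange_big_dep xpredT) //=; apply: eq_bigr => e _.
    have /andP [eV /eqP eq] := valP e.
    rewrite (eq_bigl (fun v => v \in (val e).2)) => [|v]; last first.
      by rewrite andb_idl // => /(subsetP eV).
    by rewrite sumr_const eq mulr_natl.
  apply: (@le_trans _ _ (\sum_(v in V') (mu + K * eta + eta))).
    apply: ler_sum => v _; apply: le_trans (yb _) _.
    by have /andP [_ /ltW] := bb (inl v).
  rewrite sumr_const -mulr_natl -/n.
  by have := ltW eta0; nra.
move=> a xa; rewrite ltnNge; apply/negP => /exists_subset_card [S [SB cS]].
have Xa : X a < 1 by move: xa; rewrite gt_min ltxx.
have SV : (S \subset V') && (#|S| == q).
  by rewrite cS eqxx andbT; apply: subset_trans SB _; apply/subsetP => v; rewrite inE => /andP [].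
(* The [q] dissatisfied voters form an edge. Stability saturates one of them, who then has mass mu
   weakly above [a], or saturates [a], which then has value at least 1. *)
pose e : E := exist _ (a, S) SV.
have [[v|a']] := ystable e.
  rewrite inl_inc /= => vS ysat.
  have := subsetP SB _ vS; rewrite inE => /andP [_]; rewrite ltNge => /negP; apply.
  have /andP [] := bb (inl v) => bv _.
  rewrite -(lerD2r (K * eta)); apply: le_trans (ltW bv) _; rewrite -ysat.
  apply: (@le_trans _ _ (\sum_(c in weak_upper (pref v) a) X c)).
    rewrite [leRHS](exchange_big_dep xpredT) //=.
    rewrite big_mkcond /=; apply: ler_sum => e' _.
    case: ifP => [/andP [_ /u_rk /rk_le ew]|_]; last by apply: sumr_ge0.
    by rewrite (bigD1 (val e').1) /= ?eqxx ?andbT // lerDl sumr_ge0.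
  apply: (@le_trans _ _ (\sum_(c in weak_upper (pref v) a) (x c + eta))).
    exact: ler_sum.
  rewrite big_split /= lerD2l sumr_const -mulr_natl.
  by rewrite ler_wpM2r ?ler_nat ?max_card // ltW.
rewrite inr_inc /= => /eqP -> ysat.
have : b (inr a) <= X a.
  rewrite -ysat [leRHS](bigID (fun e' => (u (inr a) e <= u (inr a) e')%N)) /=.
  under eq_bigl do rewrite inr_inc.
  by rewrite lerDl sumr_ge0.
by have /andP [] := bb (inr a) => /= h _; lra.
Qed.

End Fractional.

(** * Pipage rounding *)

Section Pipage.
Variables (R : realFieldType) (V A : finType) (w : V -> A -> R) (W : {set V}).
Hypothesis w01 : forall v c, 0 <= w v c <= 1.

Definition miss_potential (x : A -> R) : R := \sum_(v in W) \prod_c (1 - w v c * x c).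

Let unit_cube (x : A -> R) := forall c, 0 <= x c <= 1.

Definition shift (x : A -> R) (i j : A) (s : R) (c : A) : R :=
  if c == i then x c + s else if c == j then x c - s else x c.

Lemma factor_ge0 v c z : 0 <= z <= 1 -> 0 <= 1 - w v c * z.
Proof.
have /andP [w0 w1] := w01 v c => /andP [z0 z1].
by rewrite subr_ge0 mulr_ile1.
Qed.

(* Along e_i - e_j each product is a quadratic with nonpositive leading
   coefficient, hence lies below its tangent at 0. *)
Lemma miss_potential_shift x i j : unit_cube x -> i != j ->
  exists q, forall s, miss_potential (shift x i j s) <= miss_potential x + q * s.
Proof.
move=> x01 ij.
pose P v := \prod_(c | (c != i) && (c != j)) (1 - w v c * x c).
have P0 v : 0 <= P v by apply: prodr_ge0 => c _; apply: factor_ge0.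
have split2 v (y : A -> R) : (forall c, c != i -> c != j -> y c = x c) ->
    \prod_c (1 - w v c * y c) = (1 - w v i * y i) * (1 - w v j * y j) * P v.
  move=> yx; rewrite (bigD1 i) //= (bigD1 j) /=; last by rewrite eq_sym.
  rewrite mulrA; congr (_ * _); apply: eq_bigr => c /andP [ci cj].
  by rewrite yx.
exists (\sum_(v in W) (w v j * (1 - w v i * x i) - w v i * (1 - w v j * x j)) * P v).
move=> s; rewrite mulr_suml -big_split /=; apply: ler_sum => v _.
rewrite (split2 v x) // (split2 v (shift x i j s)); last first.
  by move=> c /negPf ci /negPf cj; rewrite /shift ci cj.
rewrite /shift eqxx [j == i]eq_sym (negPf ij) eqxx.
rewrite -subr_ge0 [X in 0 <= X](_ : _ = (w v i * w v j * P v) * s ^+ 2); last by ring.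
have /andP [wi _] := w01 v i; have /andP [wj _] := w01 v j.
by rewrite mulr_ge0 ?sqr_ge0 // mulr_ge0 // mulr_ge0.
Qed.

Let frac (x : A -> R) := [set c | 0 < x c < 1].

Lemma sum_shift x i j s : i != j -> \sum_c shift x i j s c = \sum_c x c.
Proof.
move=> ij; have ji : (j == i) = false by rewrite eq_sym; apply/negbTE.
rewrite (bigD1 i) // (bigD1 j) ?ji //= [RHS](bigD1 i) // [in RHS](bigD1 j) ?ji //=.
rewrite /shift eqxx ji eqxx.
rewrite (eq_bigr x) => [|c /andP [/negPf -> /negPf ->//]]; ring.
Qed.

Lemma shift_frac x i j : unit_cube x -> i != j -> i \in frac x -> j \in frac x ->
  exists2 s, 0 < s & unit_cube (shift x i j s) /\ frac (shift x i j s) \proper frac x.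
Proof.
move=> x01 ij; rewrite !inE => xi xj.
pose s := Num.min (1 - x i) (x j).
have sP : s <= 1 - x i /\ s <= x j /\ (s = 1 - x i \/ s = x j) /\ 0 < s.
  by rewrite /s; case: (leP (1 - x i) (x j)) => h; do ?split => //; try lra; auto.
have [si [sj [s_eq s0]]] := sP; exists s => //; split.
  move=> c; rewrite /shift; case: eqP => [->|_]; first by lra.
  by case: eqP => [->|_]; [lra|exact: x01].
apply/properP; split.
  apply/subsetP => c; rewrite !inE /shift; case: eqP => [->//|_].
  by case: eqP => [->|].
case: s_eq => se; [exists i|exists j]; rewrite !inE // /shift ?eqxx ?[j == i]eq_sym ?(negPf ij) ?eqxx; lra.
Qed.

(** Mass moves between two fractional coordinates, in the direction where the tangent does not rise,
    until one of them reaches 0 or 1. A single remaining fractional coordinate is rounded up: this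
    cannot raise the potential, and the size stays within [B] because [B] is an integer. *)
Lemma pipage_rounding x (B : nat) : unit_cube x -> \sum_c x c <= B%:R ->
  exists C : {set A}, [/\ (#|C| <= B)%N, forall c, x c = 1 -> c \in C &
    miss_potential (fun c => (c \in C)%:R) <= miss_potential x].
Proof.
have [m] := ubnP #|frac x|; elim: m x => // m IH x; rewrite ltnS => mx x01 xB.
have integral c : c \notin frac x -> x c = (x c == 1)%:R.
  rewrite inE; have := x01 c; case: eqP => [->//|x1]; rewrite !le_eqVlt => /andP [].
  by move=> /orP [/eqP <-//|->] /orP [/eqP //|->].
have [[i [j [ij iF jF]]]|noij] := pselect (exists i j, [/\ i != j, i \in frac x & j \in frac x]).
  have [q qP] := miss_potential_shift x01 ij.
  have key y : unit_cube y -> \sum_c y c = \sum_c x c -> frac y \proper frac x ->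
     (forall c, x c = 1 -> y c = 1) ->
     miss_potential y <= miss_potential x ->
     exists C : {set A}, [/\ (#|C| <= B)%N, forall c, x c = 1 -> c \in C &
       miss_potential (fun c => (c \in C)%:R) <= miss_potential x].
    move=> y01 yx yF y1 yP; have yB : \sum_c y c <= B%:R by rewrite yx.
    have [C [CB C1 CP]] := IH y (leq_trans (proper_card yF) mx) y01 yB.
    exists C; split => // [c /y1 /C1 //|]; exact: le_trans CP yP.
  have keep1 i' j' s : i' \in frac x -> j' \in frac x -> forall c, x c = 1 -> shift x i' j' s c = 1.
    rewrite !inE => i'F j'F c xc; rewrite /shift.
    case: eqP => [ci|_]; first by move: i'F; rewrite -ci xc ltxx andbF.
    by case: eqP => [cj|//]; move: j'F; rewrite -cj xc ltxx andbF.
  have [q0|q0] := leP q 0.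
    have [s s0 [y01 yF]] := shift_frac x01 ij iF jF.
    apply: (key (shift x i j s)) => //; [exact: sum_shift|exact: keep1|].
    by apply: le_trans (qP s) _; rewrite gerDl mulr_le0_ge0 // ltW.
  have ji : j != i by rewrite eq_sym.
  have [s s0 [y01 yF]] := shift_frac x01 ji jF iF.
  apply: (key (shift x j i s)) => //; [exact: sum_shift|exact: keep1|].
  have -> : shift x j i s = shift x i j (- s).
    apply: funext => c; rewrite /shift opprK.
    by case: eqP => [->|//]; rewrite (negPf ji).
  by apply: le_trans (qP (- s)) _; rewrite gerDl mulrN oppr_le0 mulr_ge0 // ltW.
pose C := [set c | x c == 1] :|: frac x.
exists C; split; last 2 first.
- by move=> c xc; rewrite !inE xc eqxx.
- apply: ler_sum => v _; apply: ler_prod => c _.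
  have xC : x c <= (c \in C)%:R.
    have [cC|cC] := boolP (c \in C); first by have /andP [] := x01 c.
    rewrite integral; last by apply: contraNN cC => cF; rewrite !inE in cF *; rewrite cF orbT.
    by move: cC; rewrite !inE => /norP [/negPf -> _].
  have /andP [wc _] := w01 v c.
  rewrite factor_ge0 /=; last by case: (c \in C); rewrite ?lexx ?ler01.
  by rewrite lerD2l lerN2 ler_wpM2l.
have [F0|[i iF]] := set_0Vmem (frac x).
  rewrite -(ler_nat R); apply: le_trans xB; rewrite /C F0 setU0 -sum1_card natr_sum big_mkcond /=.
  by apply: ler_sum => c _; rewrite [leRHS]integral ?F0 ?inE //; case: eqP.
have Fi : frac x = [set i].
  apply/eqP; rewrite eqEsubset sub1set iF andbT; apply/subsetP => j jF; rewrite inE.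
  by apply/negPn/negP => ji; apply: noij; exists j, i.
have xi : 0 < x i < 1 by move: iF; rewrite inE.
rewrite /C Fi setUC cardsU1 inE lt_eqF /=; last by have /andP [] := xi.
rewrite -ltnS add1n ltnS -(ltr_nat R); apply: lt_le_trans xB.
rewrite (bigD1 i) //= addrC.
apply: (@le_lt_trans _ _ (\sum_(c | c != i) x c)); last by rewrite ltrDl; have /andP [] := xi.
rewrite -sum1_card natr_sum big_mkcond [leRHS]big_mkcond /=; apply: ler_sum => c _.
rewrite inE; have [->|ci] := eqVneq c i; first by rewrite lt_eqF //; have /andP [] := xi.
by rewrite [leRHS]integral ?Fi ?inE //; case: eqP.
Qed.

End Pipage.

(** * Rounding one fractional committee *)

(* The Chernoff bound for the probability that a sum of independent indicators
   of mean mu is at most k; it equals omega gamma t for mu = gamma t, k = t - 1. *)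
Definition chernoff_tail (R : realType) (mu : R) (k : nat) : R :=
  expR (k%:R - mu) * (mu / k%:R) ^+ k.

Section OneStage.
Variables (R : realType) (V A : finType) (pref : V -> rel A).
Hypothesis pref_lin : forall v, strict_linear_order (pref v).

(** Weak upper sets of a linear order are nested, so a smallest one of mass at least mu lies in all
    the others. The premise stands inside the existential so that [U] can be chosen for all voters
    at once. *)
Lemma exists_threshold_set (x : A -> R) (mu : R) (v : V) : exists U : {set A},
  (exists a, mu <= \sum_(c in weak_upper (pref v) a) x c) ->
  mu <= \sum_(c in U) x c /\
  forall a, mu <= \sum_(c in weak_upper (pref v) a) x c -> U \subset weak_upper (pref v) a.
Proof.
have [[a0 a0P]|no] := pselect (exists a, mu <= \sum_(c in weak_upper (pref v) a) x c);
  last by exists finset.set0.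
have [irr [tr tot]] := pref_lin v.
have [a aP amin] := @arg_minnP _ a0 (fun a => mu <= \sum_(c in weak_upper (pref v) a) x c)
  (fun a => #|weak_upper (pref v) a|) a0P.
exists (weak_upper (pref v) a) => _; split => // a' a'P.
have up_sub y z : pref v y z -> weak_upper (pref v) y \subset weak_upper (pref v) z.
  move=> yz; apply/fintype.subsetP => c; rewrite !inE => /orP [/eqP ->|cy]; first by rewrite yz orbT.
  by rewrite (tr _ _ _ cy yz) orbT.
have [->//|aa'] := eqVneq a a'.
have /orP [/up_sub//|a'a] := tot _ _ aa'.
have := amin _ a'P; rewrite leqNgt => /negP []; apply: proper_card; apply/properP.
split; first exact: up_sub.
exists a; rewrite !inE ?eqxx // negb_or aa' /=; apply/negP => aa.
by have := tr _ _ _ aa a'a; rewrite irr.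
Qed.

(** [W] gathers the voters whose threshold set receives at most [k] members; each contributes at
    least lam^k to the potential, which bounds their number. A voter outside [W] can fail on [a]
    only with fractional mass below mu above [a], and the fractional committee limits these. *)
Lemma exists_one_stage (V' : {set V}) (mu : R) (k B : nat) :
  (0 < k)%N -> k.+1%:R <= mu -> (0 < B)%N ->
  exists (C : {set A}) (W : {set V}), [/\ (#|C| <= B)%N, W \subset V',
    #|W|%:R <= chernoff_tail mu k * #|V'|%:R &
    forall a, a \notin C ->
      #|[set v in V' :\: W | ~~ beats_t pref k.+1 v C a]|%:R <= mu / B%:R * #|V'|%:R].
Proof.
move=> k0 kmu B0.
have k0' : 0 < k%:R :> R by rewrite ltr0n.
have B0' : 0 < B%:R :> R by rewrite ltr0n.
have kmu' : k%:R + 1 <= mu by rewrite natr1.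
have mu0 : 0 < mu by lra.
pose n : R := #|V'|%:R.
have n0 : 0 <= n by rewrite ler0n.
pose z := mu / B%:R * n.
have z0 : 0 <= z by rewrite mulr_ge0 // divr_ge0 ?ltW.
(* The successor makes [muq] strict, while fewer than [q] voters still means at most [z]. *)
pose q := (Num.truncn z).+1.
have qz : q.-1%:R <= z by rewrite /q /= truncn_le.
have zq : z < q%:R by exact: truncnS_gt.
have muq : mu * n < q%:R * B%:R.
  by rewrite -ltr_pdivrMr //; move: zq; rewrite /z mulrAC.
have [x [x01 xB xq]] := exists_fractional_committee
   (fun v => (pref_lin v).1) (fun v => (pref_lin v).2.1) (fun v => (pref_lin v).2.2)
   mu0 (ltn0Sn _) muq.
have [U UP] := fin_all_exists (exists_threshold_set x mu).
pose sat v := `[< exists a, mu <= \sum_(c in weak_upper (pref v) a) x c >].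
pose W0 := [set v in V' | sat v].
(* A voter with j members in the threshold set contributes lam^j; this value minimises the resulting
   bound e^(-(1 - lam) mu) / lam^k. *)
pose lam := k%:R / mu.
have lam0 : 0 < lam by rewrite divr_gt0.
have lam1 : lam <= 1 by rewrite ler_pdivrMr // mul1r; lra.
pose w (v : V) (c : A) := (1 - lam) * (c \in U v)%:R.
have w01 v c : 0 <= w v c <= 1.
  by rewrite /w; case: (c \in U v); rewrite ?mulr1 ?mulr0; lra.
have [C [CB C1 CP]] := pipage_rounding W0 w01 x01 xB.
pose W := [set v in W0 | (#|C :&: U v| <= k)%N].
exists C, W; split => //.
- by apply/fintype.subsetP => v; rewrite !inE => /andP [/andP []].
- have low : #|W|%:R * lam ^+ k <= miss_potential w W0 (fun c => (c \in C)%:R).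
    rewrite mulr_natl -sumr_const big_mkcond [leRHS]big_mkcond /=.
    apply: ler_sum => v _.
    have prodE : \prod_c (1 - w v c * (c \in C)%:R) = lam ^+ #|C :&: U v|.
      rewrite -prodr_const [RHS]big_mkcond /=; apply: eq_bigr => c _.
      by rewrite /w inE; case: (c \in C); case: (c \in U v); rewrite /= ?mulr1 ?mulr0; ring.
    rewrite prodE inE; case: (v \in W0) => //=.
    case: (leqP #|C :&: U v| k) => Ck; last by rewrite exprn_ge0 // ltW.
    by rewrite ler_wiXn2l // ltW.
  have high : miss_potential w W0 x <= n * expR (- ((1 - lam) * mu)).
    apply: (@le_trans _ _ (\sum_(v in W0) expR (- ((1 - lam) * mu)))).
      apply: ler_sum => v; rewrite inE => /andP [_ /asboolP sv].
      have [Umu _] := UP v sv.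
      apply: (@le_trans _ _ (\prod_c expR (- (w v c * x c)))).
        apply: ler_prod => c _; rewrite expR_ge1Dx andbT.
        have /andP [? ?] := w01 v c; have /andP [? ?] := x01 c.
        by rewrite subr_ge0 mulr_ile1.
      rewrite -expR_sum ler_expR sumrN lerN2.
      rewrite (eq_bigr (fun c => (1 - lam) * (if c \in U v then x c else 0))) => [|c _]; last first.
        by rewrite /w; case: (c \in U v); rewrite ?mulr1 ?mulr0 ?mul0r.
      rewrite -mulr_sumr -big_mkcond /= ler_wpM2l // subr_ge0 //.
    rewrite sumr_const -mulr_natl ler_wpM2r ?expR_ge0 // ler_nat subset_leq_card //.
    by apply/fintype.subsetP => v; rewrite inE => /andP [].
  have : #|W|%:R * lam ^+ k <= n * expR (- ((1 - lam) * mu)).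
    exact: le_trans low (le_trans CP high).
  rewrite -ler_pdivlMr ?exprn_gt0 // => /le_trans; apply.
  have -> : - ((1 - lam) * mu) = k%:R - mu by rewrite /lam; field; rewrite gt_eqF.
  have -> : (lam ^+ k)^-1 = (mu / k%:R) ^+ k by rewrite -exprVn /lam invf_div.
  by rewrite /chernoff_tail le_eqVlt; apply/orP; left; apply/eqP; rewrite /n; ring.
move=> a aC; apply: le_trans qz.
rewrite ler_nat -ltnS; apply: leq_ltn_trans (xq a _); last first.
  have /andP [_] := x01 a; rewrite le_eqVlt => /orP [/eqP /C1|//].
  by rewrite (negPf aC).
apply/subset_leq_card/fintype.subsetP => v; rewrite !inE => /andP [/andP [vW vV] nb].
rewrite vV ltNge; apply/negP => mua; move/negP: nb; apply.
have sv : sat v by apply/asboolP; exists a.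
have [_ /(_ _ mua) Usub] := UP v (asboolW sv).
move: vW; rewrite vV sv /= -ltnNge => /leq_trans; apply.
apply/subset_leq_card/fintype.subsetP => c; rewrite !inE => /andP [cC /(fintype.subsetP Usub)].
rewrite inE cC => /orP [/eqP ca|//]; by rewrite -ca cC in aC.
Qed.

End OneStage.

(** * Chernoff tails and committee sizes *)

Section Tail.
Variable R : realType.
Implicit Types mu tau alpha : R.

Lemma bernoulli_ineq (x : R) n : 0 <= x -> 1 + n%:R * x <= (1 + x) ^+ n.
Proof.
move=> x0; elim: n => [|n IH]; first by rewrite mul0r addr0.
rewrite exprS; apply: (@le_trans _ _ ((1 + x) * (1 + n%:R * x))); last first.
  by rewrite ler_wpM2l // addr_ge0.
have -> : n.+1%:R = n%:R + 1 :> R by rewrite natr1.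
have := mulr_ge0 (ler0n R n) (sqr_ge0 x); rewrite expr2; lra.
Qed.

Lemma chernoff_tail_gt0 mu k : 0 < mu -> (0 < k)%N -> 0 < chernoff_tail mu k.
Proof. by move=> mu0 k0; rewrite mulr_gt0 ?expR_gt0 // exprn_gt0 // divr_gt0 // ltr0n. Qed.

Lemma expR1_lt3 : expR 1 < 3 :> R.
Proof.
(* 6 is the least n with (1 - 1/n)^n > 1/3. *)
have h : 5 / 6 <= expR (- (1 / 6)) :> R by apply: le_trans (expR_ge1Dx _); lra.
have : (5 / 6) ^+ 6 <= expR (- (1 / 6)) ^+ 6 :> R by rewrite lerXn2r // ?nnegrE ?expR_ge0 //; lra.
rewrite -expRM_natr (_ : - (1 / 6) * 6 = -1) ?expRN; last by lra.
move=> h6; have e0 := expR_gt0 (1 : R).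
rewrite ltNge; apply/negP => e3.
have : (expR 1)^-1 <= 3^-1 :> R by rewrite lef_pV2 ?posrE.
by move: h6; rewrite !exprS expr0; lra.
Qed.

Lemma expR_nat_lt3X n : (0 < n)%N -> expR n%:R < 3 ^+ n :> R.
Proof.
by move=> n0; rewrite -[n%:R]mul1r expRM_natr ltrXn2r ?expR_ge0 ?expR1_lt3 // -lt0n.
Qed.

(** For s = mu - k in [1, 3), Bernoulli gives a tail of at least (1 + s) e^(-s), while e^s < (1 +
    s)^2 (2 + s). The conclusion makes mu - 2 still admissible, that is, at least k + 1. *)
Lemma chernoff_tail_small mu k : (0 < k)%N -> k.+1%:R <= mu ->
  chernoff_tail mu k * mu * (1 + mu) < 1 -> k%:R + 3 <= mu.
Proof.
move=> k0 kmu hm; rewrite leNgt; apply/negP => muk.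
have k0' : 1 <= k%:R :> R by rewrite ler1n.
have kmu' : k%:R + 1 <= mu by rewrite natr1.
pose s := mu - k%:R.
have tail_ge : (1 + s) * expR (- s) <= chernoff_tail mu k.
  rewrite /chernoff_tail -opprB -/s mulrC ler_wpM2l ?expR_ge0 //.
  have -> : mu / k%:R = 1 + s / k%:R by rewrite /s; field; rewrite gt_eqF // (lt_le_trans ltr01).
  have -> : 1 + s = 1 + k%:R * (s / k%:R) by field; rewrite gt_eqF // (lt_le_trans ltr01).
  by apply: bernoulli_ineq; rewrite divr_ge0 // /s; lra.
have s1 : 1 <= s by rewrite /s; lra.
have sbig : expR s < (1 + s) * (1 + s) * (2 + s).
  have [s2|s2] := leP s 2.
    apply: (@lt_trans _ _ (3 ^+ 2)).
      by apply: le_lt_trans (expR_nat_lt3X (n := 2) isT); rewrite ler_expR.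
    have : 2 * 2 <= (1 + s) * (1 + s) by apply: ler_pM => //; lra.
    by rewrite expr2 => h; have := ler_pM _ _ h (_ : 3 <= 2 + s); lra.
  apply: (@lt_trans _ _ (3 ^+ 3)).
    by apply: le_lt_trans (expR_nat_lt3X (n := 3) isT); rewrite ler_expR /s; lra.
  have : 3 * 3 <= (1 + s) * (1 + s) by apply: ler_pM => //; lra.
  by rewrite !exprS expr0 => h; have := ler_pM _ _ h (_ : 4 <= 2 + s); lra.
have musq : (1 + s) * (2 + s) <= mu * (1 + mu) by apply: ler_pM; rewrite /s; lra.
have : 1 < (1 + s) * expR (- s) * ((1 + s) * (2 + s)).
  rewrite expRN mulrAC -ltr_pdivrMr ?invr_gt0 ?expR_gt0 // invrK mul1r; lra.
apply/negP; rewrite -leNgt; apply: le_trans (ltW hm); rewrite -[leRHS]mulrA.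
apply: ler_pM => //; first by rewrite mulr_ge0 ?expR_ge0 //; lra.
by apply: mulr_ge0; lra.
Qed.

(** The exponential grows by e^2 < 9, and ((mu - 2) / mu)^k <= (mu - 2) / mu as k >= 1. *)
Lemma chernoff_tail_shift mu k : (0 < k)%N -> 2 <= mu ->
  chernoff_tail (mu - 2) k * mu <= 9 * chernoff_tail mu k * (mu - 2).
Proof.
move=> k0 mu2; rewrite /chernoff_tail.
have k0' : 1 <= k%:R :> R by rewrite ler1n.
have -> : k%:R - (mu - 2) = 2 + (k%:R - mu) by ring.
rewrite expRD; set E := expR (k%:R - mu).
have E0 : 0 < E by apply: expR_gt0.
have e2 : expR 2 <= 9 :> R.
  by apply: ltW; apply: lt_le_trans (expR_nat_lt3X (n := 2) isT) _; rewrite expr2; lra.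
have P : ((mu - 2) / k%:R) ^+ k * mu <= (mu / k%:R) ^+ k * (mu - 2).
  case: k k0 k0' {E E0} => // k _ k1.
  have -> : ((mu - 2) / k.+1%:R) ^+ k.+1 * mu =
     ((mu - 2) / k.+1%:R) ^+ k * ((mu - 2) * mu / k.+1%:R) by rewrite exprSr; field; rewrite gt_eqF // (lt_le_trans ltr01).
  have -> : (mu / k.+1%:R) ^+ k.+1 * (mu - 2) =
     (mu / k.+1%:R) ^+ k * ((mu - 2) * mu / k.+1%:R) by rewrite exprSr; field; rewrite gt_eqF // (lt_le_trans ltr01).
  apply: ler_wpM2r.
    by rewrite divr_ge0 ?mulr_ge0 //; lra.
  apply: lerXn2r; rewrite ?nnegrE ?divr_ge0 //; try lra.
  by rewrite ler_wpM2r ?invr_ge0 //; lra.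
rewrite -mulrA; apply: (@le_trans _ _ (9 * E * ((mu / k%:R) ^+ k * (mu - 2)))); last by rewrite !mulrA lexx.
apply: ler_pM => //; first by rewrite mulr_ge0 ?expR_ge0.
  by rewrite mulr_ge0 ?exprn_ge0 ?divr_ge0 //; lra.
by rewrite ler_wpM2r // ltW.
Qed.

(** The inequality of [one_stage_budget] for mu' = mu, cleared of denominators and with a favourable
    term dropped: w is tau times the tail, r is alpha (tau - 1), and [1 - r <= alpha] says alpha *
    tau >= 1. *)
Lemma one_stage_slack (alpha mu w r : R) : 0 < alpha -> alpha <= 1 -> 1 <= mu ->
  0 <= w -> w < 1 -> 0 < r -> 1 - r <= alpha ->
  [\/ r < 1, r <= alpha * mu | alpha <= mu * w] ->
  r * alpha * (1 - w) <= mu * (alpha - w + w * r).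
Proof.
move=> a0 a1 mu1 w0 w1 r0 ra H.
have h1 : 0 <= alpha * (1 - w) by apply: mulr_ge0; lra.
have [r1|r1] := ltP r 1.
  have h2 : 0 <= w * (alpha - 1 + r) by apply: mulr_ge0; lra.
  have h3 : 0 <= (1 - r) * (alpha * (1 - w)) by apply: mulr_ge0; lra.
  have h4 : 0 <= (mu - 1) * (alpha - w + w * r) by apply: mulr_ge0; lra.
  lra.
have h2 : 0 <= w * (r * alpha) by rewrite mulr_ge0 // mulr_ge0; lra.
case: H => [|rm|am]; first by lra.
  have h3 : 0 <= w * (r - 1) * mu by rewrite mulr_ge0 ?mulr_ge0; lra.
  have h4 : 0 <= alpha * (alpha * mu - r) by apply: mulr_ge0; lra.
  have h5 : 0 <= alpha * mu * (1 - alpha) by rewrite mulr_ge0 ?mulr_ge0; lra.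
  lra.
have h3 : 0 <= (r - 1) * (mu * w - alpha) by apply: mulr_ge0; lra.
have h4 : 0 <= alpha * (mu - 1) by apply: mulr_ge0; lra.
lra.
Qed.

(* One stage suffices when alpha is at least 1 / tau.  For large tau the
   rounding up of the committee size is paid for by lowering mu to mu - 2. *)
Lemma one_stage_budget mu k tau alpha : (0 < k)%N -> k.+1%:R <= mu -> 1 < tau ->
  chernoff_tail mu k * tau < 1 -> 1 <= alpha * tau -> alpha < 1 ->
  exists mu', [/\ k.+1%:R <= mu', chernoff_tail mu' k < alpha &
    mu' / (alpha - chernoff_tail mu' k) + 1 <=
      mu * tau / ((tau - 1) * (1 - chernoff_tail mu k * tau) * alpha)].
Proof.
move=> k0 kmu tau1 w1 at1 a1; set h := chernoff_tail mu k.
have k0' : 1 <= k%:R :> R by rewrite ler1n.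
have kmu' : k%:R + 1 <= mu by rewrite natr1.
have mu2 : 2 <= mu by lra.
have h0 : 0 < h by apply: chernoff_tail_gt0 => //; lra.
have a0 : 0 < alpha by rewrite -(pmulr_lgt0 _ (lt_trans ltr01 tau1)); lra.
pose w := h * tau; rewrite -/h -/w in w1 *.
have w0 : 0 < w by rewrite mulr_gt0 //; lra.
pose r := alpha * (tau - 1).
have r0 : 0 < r by rewrite mulr_gt0 //; lra.
have ra : 1 - r <= alpha by rewrite /r; lra.
have ha : h < alpha.
  have : h * tau < alpha * tau by rewrite -/w; lra.
  by rewrite ltr_pM2r //; lra.
have D0 : 0 < (tau - 1) * (1 - w) * alpha by apply: mulr_gt0 => //; apply: mulr_gt0; lra.
have [H|H] := pselect [\/ r < 1, r <= alpha * mu | alpha <= mu * w].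
  exists mu; split => //.
  have := one_stage_slack a0 (ltW a1) (le_trans (ler1n R 2) mu2) (ltW w0) w1 r0 ra H => slack.
  have G0 : 0 < alpha - h by lra.
  have -> : mu / (alpha - h) + 1 = (mu + (alpha - h)) / (alpha - h) by field; rewrite gt_eqF.
  rewrite ler_pdivrMr // mulrAC ler_pdivlMr //.
  have e1 : 0 <= h * r * (1 - w) by apply: mulr_ge0; [apply: mulr_ge0; lra|lra].
  move: slack e1; rewrite /r /w; lra.
(* In the remaining case tau > mu + 1 and [h] is below alpha / (mu tau), small enough to force mu >=
   k + 3. *)
have [r1 rm am] : [/\ 1 <= r, alpha * mu < r & mu * w < alpha].
  by split; rewrite leNgt || rewrite ltNge; apply/negP => h1; apply: H;
    [apply: Or31|apply: Or32|apply: Or33].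
have tm : mu + 1 < tau by move: rm; rewrite /r ltr_pM2l //; lra.
have hmt : h * mu * tau < alpha by move: am; rewrite /w; lra.
have hmu0 : 0 < h * mu by rewrite mulr_gt0 //; lra.
have hm : h * mu * (1 + mu) < 1.
  have : h * mu * (1 + mu) <= h * mu * tau by rewrite ler_pM2l //; lra.
  by lra.
have kmu3 := chernoff_tail_small k0 kmu hm.
exists (mu - 2); set h' := chernoff_tail (mu - 2) k.
have h'0 : 0 < h' by apply: chernoff_tail_gt0 => //; lra.
have sh : h' * mu <= 9 * h * (mu - 2) by apply: chernoff_tail_shift.
(* With this, the 2 taken off mu outweighs the unit of rounding and the loss in the denominator. It
   rests on 9 (mu - 2) <= mu (mu + 1), that is, (mu - 4)^2 + 2 >= 0. *)
have h'm : h' * mu <= alpha.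
  rewrite -(@ler_pM2r _ (mu * tau)); last by rewrite mulr_gt0; lra.
  apply: (@le_trans _ _ (9 * h * (mu - 2) * (mu * tau))).
    by rewrite ler_wpM2r // mulr_ge0; lra.
  have e1 : 0 <= (9 * (mu - 2)) * (alpha - h * mu * tau) by rewrite mulr_ge0; lra.
  have e2 : 0 <= alpha * (mu * (tau - mu - 1)) by rewrite !mulr_ge0; lra.
  have e3 : 0 <= alpha * (mu ^+ 2 - 8 * mu + 18).
    by rewrite mulr_ge0 ?ltW //; have := sqr_ge0 (mu - 4); rewrite !expr2; lra.
  move: e3; rewrite expr2; lra.
have h'a : h' < alpha.
  have : h' * 2 <= h' * mu by rewrite ler_pM2l.
  by lra.
split => //; first by rewrite -natr1; lra.
apply: (@le_trans _ _ (mu / alpha)); last first.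
  have -> : mu / alpha = mu * ((tau - 1) * (1 - w)) / ((tau - 1) * (1 - w) * alpha).
    by field; rewrite !gt_eqF //; lra.
  rewrite ler_wpM2r ?invr_ge0 ?(ltW D0) // ler_wpM2l //; first by lra.
  have : 0 <= w * (tau - 1) by rewrite mulr_ge0; lra.
  by lra.
have G0 : 0 < alpha - h' by lra.
have -> : (mu - 2) / (alpha - h') + 1 = (mu - 2 + (alpha - h')) / (alpha - h') by field; rewrite gt_eqF.
rewrite ler_pdivrMr // mulrAC ler_pdivlMr //.
have e1 : 0 <= alpha * h' by rewrite mulr_ge0 // ltW.
have e2 : 0 <= alpha * (1 - alpha) by rewrite mulr_ge0; lra.
lra.
Qed.

End Tail.

(** * Iterated stages *)

Section Stages.
Variables (R : realType) (V A : finType) (pref : V -> rel A) (k : nat).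
Hypothesis pref_lin : forall v, strict_linear_order (pref v).
Hypothesis k_gt0 : (0 < k)%N.
Hypothesis cardA : (k < #|A|)%N.

Definition undominated_in (V' : {set V}) (alpha : R) (C : {set A}) : Prop :=
  forall a, a \notin C ->
    #|[set v in V' | ~~ beats_t pref k.+1 v C a]|%:R <= alpha * #|V'|%:R.

(** All sets of voters are covered because later stages run on the voters left over; a real bound
    lets closed formulas be compared directly. *)
Definition achievable (alpha X : R) : Prop := forall V' : {set V},
  exists C : {set A}, [/\ (k < #|C|)%N, #|C|%:R <= X & undominated_in V' alpha C].

Lemma beats_t_subset v (C D : {set A}) a : C \subset D ->
  beats_t pref k.+1 v C a -> beats_t pref k.+1 v D a.
Proof.
move=> CD /leq_trans; apply; apply/subset_leq_card/fintype.subsetP => c.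
by rewrite !inE => /andP [/(fintype.subsetP CD) -> ->].
Qed.

Lemma undominated_in_subset V' alpha (C D : {set A}) : C \subset D ->
  undominated_in V' alpha C -> undominated_in V' alpha D.
Proof.
move=> CD uC a aD; apply: le_trans (uC a _); last by apply: contraNN aD; apply: (fintype.subsetP CD).
rewrite ler_nat; apply/subset_leq_card/fintype.subsetP => v; rewrite !inE => /andP [->] /=.
by apply: contraNN; apply: beats_t_subset.
Qed.

Lemma exists_superset_card (C : {set A}) :
  exists D : {set A}, [/\ C \subset D, (k < #|D|)%N & (#|D| <= maxn #|C| k.+1)%N].
Proof.
have [kC|Ck] := ltnP k #|C|; first by exists C; split => //; lia.
have cC : (#|C| + #|~: C| = #|A|)%N by rewrite cardsC.
have [S [SC cS]] := @exists_subset_card A (~: C) (k.+1 - #|C|) ltac:(lia).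
have CS : #|C :|: S| = k.+1.
  rewrite cardsU disjoint_setI0 ?cards0; first by lia.
  by rewrite disjoint_sym finset.disjoints_subset.
exists (C :|: S); split; [exact: finset.subsetUl|by rewrite CS|by rewrite CS leq_maxr].
Qed.

Lemma achievable_le alpha X Y : X <= Y -> achievable alpha X -> achievable alpha Y.
Proof.
by move=> XY aX V'; have [C [? CX ?]] := aX V'; exists C; split => //; apply: le_trans CX XY.
Qed.

Lemma achievable1 : achievable 1 k.+1%:R.
Proof.
move=> V'; have [C [_ kC Ck]] := exists_superset_card finset.set0; exists C; split => //.
  by move: Ck; rewrite cards0 max0n ler_nat.
move=> a _; rewrite mul1r ler_nat; apply/subset_leq_card/fintype.subsetP => v.
by rewrite inE => /andP [].
Qed.

Lemma achievable_one_stage (alpha mu : R) (B : nat) :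
  k.+1%:R <= mu -> (0 < B)%N -> alpha <= 1 -> mu / B%:R + chernoff_tail mu k <= alpha ->
  achievable alpha B%:R.
Proof.
move=> kmu B0 a1 muB V'.
have B0' : 0 < B%:R :> R by rewrite ltr0n.
have mu0 : 0 < mu by apply: lt_le_trans kmu; rewrite ltr0n.
have h0 := chernoff_tail_gt0 mu0 k_gt0.
(* Hence padding the committee to k + 1 members does not exceed [B]. *)
have kB : (k < B)%N.
  rewrite -(ler_nat R); apply: le_trans kmu _.
  have : mu / B%:R <= 1 by lra.
  by rewrite ler_pdivrMr // mul1r.
have [C [W [CB WV Wle CW]]] := exists_one_stage pref_lin V' k_gt0 kmu B0.
have [D [CD kD Dk]] := exists_superset_card C; exists D; split => //.
  by rewrite ler_nat; lia.
apply: undominated_in_subset CD _ => a aC.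
apply: (@le_trans _ _ ((mu / B%:R + chernoff_tail mu k) * #|V'|%:R)); last by rewrite ler_wpM2r.
rewrite mulrDl; apply: le_trans (lerD (CW a aC) Wle); rewrite -natrD ler_nat.
apply: leq_trans (leq_card_setU _ _); apply/subset_leq_card/fintype.subsetP => v; rewrite !inE.
by move=> /andP [-> ->]; case: (v \in W).
Qed.

(** A second committee treats the left-over voters [W] at tolerance beta relative to [W]; enlarging
    a committee preserves every voter already served. *)
Lemma achievable_step (alpha beta mu X : R) (B : nat) :
  k.+1%:R <= mu -> (0 < B)%N -> 0 <= beta -> mu / B%:R + chernoff_tail mu k * beta <= alpha ->
  achievable beta X -> achievable alpha (B%:R + X).
Proof.
move=> kmu B0 b0 muB aX V'.
have [C [W [CB WV Wle CW]]] := exists_one_stage pref_lin V' k_gt0 kmu B0.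
have [D [kD DX DW]] := aX W; exists (C :|: D); split.
- by apply: leq_trans kD _; apply/subset_leq_card/finset.subsetUr.
- apply: le_trans (lerD (_ : #|C|%:R <= _) DX); last by rewrite ler_nat.
  by rewrite -natrD ler_nat leq_card_setU.
move=> a; rewrite inE => /norP [aC aD].
apply: (@le_trans _ _ ((mu / B%:R + chernoff_tail mu k * beta) * #|V'|%:R)); last by rewrite ler_wpM2r.
rewrite mulrDl; apply: (@le_trans _ _ (mu / B%:R * #|V'|%:R + beta * #|W|%:R)); last first.
  by rewrite lerD2l [chernoff_tail _ _ * _]mulrC -mulrA ler_wpM2l.
apply: le_trans (lerD (CW a aC) (DW a aD)); rewrite -natrD ler_nat.
apply: leq_trans (leq_card_setU _ _); apply/subset_leq_card/fintype.subsetP => v; rewrite !inE.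
move=> /andP [-> nb] /=; case: (v \in W) => /=.
  by apply: contraNN nb; apply: beats_t_subset; apply: finset.subsetUr.
by rewrite orbF; apply: contraNN nb; apply: beats_t_subset; apply: finset.subsetUl.
Qed.

(** With w = tau * [chernoff_tail mu k], the first term sums the series of stage sizes mu / ((1 - w)
    alpha tau^i), and the logarithm pays for rounding. At mu = gamma t this is the expression under
    the infimum in [s1]. *)
Definition stage_total (mu tau alpha : R) : R :=
  mu * tau / ((tau - 1) * (1 - chernoff_tail mu k * tau) * alpha)
  + logb tau (1 / ((1 - chernoff_tail mu k * tau) * alpha)).

Lemma exists_nat_between (y : R) : 0 <= y ->
  exists B : nat, [/\ (0 < B)%N, y <= B%:R & B%:R <= y + 1].
Proof.
move=> y0; exists (Num.truncn y).+1; split => //; first exact/ltW/truncnS_gt.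
by rewrite -natr1 lerD2r truncn_le.
Qed.

(* A geometric sequence of stages: the committee of a stage is tau times
   smaller than the one before, while the tolerated fraction of the voters that
   are left over is tau times larger. *)
Lemma achievable_stages (mu tau alpha : R) : k.+1%:R <= mu -> 1 < tau ->
  chernoff_tail mu k * tau < 1 -> 0 < alpha -> alpha <= 1 ->
  achievable alpha (stage_total mu tau alpha).
Proof.
move=> kmu tau1 w1.
have mu0 : 0 < mu by apply: lt_le_trans kmu; rewrite ltr0n.
have h0 := chernoff_tail_gt0 mu0 k_gt0.
pose h := chernoff_tail mu k; pose w := h * tau.
have lntau : 0 < ln tau by apply: ln_gt0.
have w0 : 0 < w by rewrite mulr_gt0 //; lra.
have w1' : w < 1 by [].
have D0 a : 0 < a -> 0 < (tau - 1) * (1 - w) * a.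
  by move=> a0; rewrite mulr_gt0 // mulr_gt0 // subr_gt0.
have first_ge a : 0 < a -> mu / a <= mu * tau / ((tau - 1) * (1 - w) * a).
  move=> a0.
  have -> : mu / a = mu * ((tau - 1) * (1 - w)) / ((tau - 1) * (1 - w) * a).
    by field; rewrite !gt_eqF //= ?subr_gt0.
  rewrite ler_wpM2r ?invr_ge0 ?(ltW (D0 _ a0)) // ler_wpM2l ?(ltW mu0) //.
  have : 0 <= w * (tau - 1) by rewrite mulr_ge0 // ?subr_ge0 ltW.
  by lra.
have log_ge0 a : 0 < a -> a <= 1 -> 0 <= logb tau (1 / ((1 - w) * a)).
  move=> a0 a1; rewrite divr_ge0 ?(ltW lntau) // ln_ge0 //.
  rewrite ler_pdivlMr ?mul1r; last by rewrite mulr_gt0 // subr_gt0.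
  by rewrite mulr_ile1 ?(ltW a0) //; lra.
have base a : 0 < a -> a <= 1 -> 1 <= a * tau -> achievable a (stage_total mu tau a).
  move=> a0; rewrite le_eqVlt => /orP [/eqP -> _|a1 at1].
    apply: achievable_le achievable1; apply: le_trans kmu _.
    by have := first_ge 1 ltr01; have := log_ge0 1 ltr01 (lexx _); rewrite /stage_total -/h -/w divr1; lra.
  have [mu' [kmu' h'a budget]] := one_stage_budget k_gt0 kmu tau1 w1 at1 a1.
  set h' := chernoff_tail mu' k in h'a budget.
  have y0 : 0 <= mu' / (a - h').
    by rewrite divr_ge0 ?subr_ge0 ?(ltW h'a) //; apply: le_trans kmu'; rewrite ler0n.
  have [B [B0 yB By]] := exists_nat_between y0.
  have a'0 : 0 < a - h' by rewrite subr_gt0.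
  have B0' : 0 < B%:R :> R by rewrite ltr0n.
  apply: (@achievable_le _ B%:R).
    by have := log_ge0 a a0 (ltW a1); rewrite /stage_total -/h -/w in budget *; lra.
  apply: achievable_one_stage kmu' B0 (ltW a1) _; rewrite -/h'.
  rewrite -lerBrDr ler_pdivrMr // mulrC -ler_pdivrMr //.
move=> a0 a1.
have [n an] : exists n, 1 <= alpha * tau ^+ n * tau.
  pose n := (Num.truncn (1 / (alpha * (tau - 1)))).+1; exists n.
  have := truncnS_gt (1 / (alpha * (tau - 1))); rewrite -/n.
  rewrite ltr_pdivrMr; last by rewrite mulr_gt0 // subr_gt0.
  move=> hn; have := @bernoulli_ineq R (tau - 1) n (ltac:(by rewrite subr_ge0 ltW)).
  rewrite [1 + (tau - 1)]addrC subrK => bn.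
  have : alpha * (1 + n%:R * (tau - 1)) <= alpha * tau ^+ n by rewrite ler_wpM2l // ltW.
  move=> bn'; have t1 : 1 <= alpha * tau ^+ n by lra.
  by rewrite -[1]mulr1 ler_pM // ltW.
elim: n alpha a0 a1 an => [|n IH] alpha a0 a1 an.
  by apply: base => //; move: an; rewrite expr0 mulr1.
have [at1|at1] := leP (alpha * tau) 1; last by apply: base => //; apply: ltW.
have at0 : 0 < alpha * tau by rewrite mulr_gt0 //; lra.
have ac := IH (alpha * tau) at0 at1 ltac:(by move: an; rewrite exprS !mulrA).
have aw0 : 0 < alpha * (1 - w) by rewrite mulr_gt0 // subr_gt0.
(* The tolerance alpha splits into alpha (1 - w) for this stage and alpha w = h (alpha tau) for the
   voters left over. *)
have [B [B0 yB By]] := @exists_nat_between (mu / (alpha * (1 - w))) (ltac:(by rewrite divr_ge0 ?ltW)).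
have B0' : 0 < B%:R :> R by rewrite ltr0n.
have := achievable_step kmu B0 (ltW at0) _ ac => /(_ alpha) ac'.
apply: achievable_le (ac' _); last first.
  have : mu / B%:R <= alpha * (1 - w).
    by rewrite ler_pdivrMr // mulrC -ler_pdivrMr.
  by rewrite /w /h; lra.
apply: (@le_trans _ _ (mu / (alpha * (1 - w)) + 1 + stage_total mu tau (alpha * tau))).
  by rewrite lerD2r.
rewrite le_eqVlt; apply/orP; left; apply/eqP; rewrite /stage_total -/h -/w.
(* This drop by 1 pays for rounding [B] up. *)
have -> : logb tau (1 / ((1 - w) * (alpha * tau))) = logb tau (1 / ((1 - w) * alpha)) - 1.
  rewrite /logb !div1r mulrA [in LHS]invfM ln_div ?posrE ?invr_gt0 ?mulr_gt0 ?subr_gt0 //; last by lra.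
  by field; rewrite gt_eqF.
have tn : tau != 0 by rewrite gt_eqF //; lra.
have tn1 : tau - 1 != 0 by rewrite gt_eqF // subr_gt0.
have wn : 1 - w != 0 by rewrite gt_eqF // subr_gt0.
have an0 : alpha != 0 by rewrite gt_eqF.
by field; rewrite tn tn1 wn an0.
Qed.

End Stages.

(** * Bounds on delta *)

Local Open Scope classical_set_scope.
Local Open Scope ring_scope.

Section Delta.
Variable R : realType.
Implicit Types (gamma tau alpha : R) (k t : nat).

(** * Estimates of [omega] *)

Lemma omegaE gamma k : 1 <= gamma -> (0 < k)%N ->
  omega gamma k.+1 = chernoff_tail (gamma * k.+1%:R) k.
Proof.
move=> g1 k0; rewrite /omega /chernoff_tail; set mu := gamma * k.+1%:R.
have mu0 : 0 < mu by rewrite mulr_gt0 ?ltr0n //; lra.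
have k0' : 0 < k%:R :> R by rewrite ltr0n.
have -> : k.+1%:R - 1 = k%:R :> R by rewrite -natr1 addrK.
have -> : mu - k.+1%:R + 1 = mu - k%:R by rewrite -natr1; ring.
have muk : 0 < mu / k%:R by rewrite divr_gt0.
have kmu : 0 < k%:R / mu by rewrite divr_gt0.
have -> : (mu / k%:R) ^+ k = expR (k%:R * ln (mu / k%:R)).
  by rewrite expRM_natl lnK ?posrE.
rewrite {2}/powR gt_eqF // -expRB -expRM -expRD; congr expR.
rewrite [ln (mu / k%:R)]ln_div ?posrE // ln_div ?posrE //.
by field; rewrite gt_eqF.
Qed.

Lemma omega_gt0 gamma k : 1 <= gamma -> (0 < k)%N -> 0 < omega gamma k.+1.
Proof.
move=> g1 k0; rewrite omegaE // chernoff_tail_gt0 // mulr_gt0 ?ltr0n //; lra.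
Qed.

Lemma omega_ge_expR gamma k : 1 <= gamma -> (0 < k)%N ->
  expR (- (gamma * k.+1%:R)) <= omega gamma k.+1.
Proof.
move=> g1 k0; rewrite omegaE // /chernoff_tail expRD mulrAC.
have k0' : 0 < k%:R :> R by rewrite ltr0n.
have k1 : k.+1%:R = k%:R + 1 :> R by rewrite natr1.
rewrite ler_peMl ?expR_ge0 //; apply: mulr_ege1.
  by apply: le_trans (expR_ge1Dx _); rewrite lerDl ltW.
rewrite exprn_ege1 // ler_pdivlMr // mul1r k1.
apply: le_trans (_ : 1 * (k%:R + 1) <= _); first by lra.
by rewrite ler_wpM2r //; lra.
Qed.

(** The geometric rate at which [omega gamma t] decreases in t, below 1 as soon as gamma > 1. *)
Definition decay gamma : R := gamma * expR (1 - gamma).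

Lemma decay_ge0 gamma : 1 <= gamma -> 0 <= decay gamma.
Proof. by move=> g1; rewrite mulr_ge0 ?expR_ge0 //; lra. Qed.

Lemma decay_le1 gamma : decay gamma <= 1.
Proof.
rewrite /decay -opprB expRN ler_pdivrMr ?expR_gt0 // mul1r.
by have := expR_ge1Dx (gamma - 1); lra.
Qed.

(** After cancellation this is (1 + 1/k)^k <= e. *)
Lemma omega_le_decay gamma k : 1 <= gamma -> (0 < k)%N ->
  omega gamma k.+1 <= decay gamma ^+ k.+1 / gamma.
Proof.
move=> g1 k0; rewrite omegaE // /chernoff_tail /decay.
have k0' : 0 < k%:R :> R by rewrite ltr0n.
have g0 : 0 < gamma by lra.
have k1 : k.+1%:R = k%:R + 1 :> R by rewrite natr1.
have -> : (gamma * expR (1 - gamma)) ^+ k.+1 / gamma =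
    expR (k%:R - gamma * k.+1%:R) * (gamma ^+ k * expR 1).
  rewrite exprMn exprS -expRM_natr.
  have -> : (1 - gamma) * k.+1%:R = (k%:R - gamma * k.+1%:R) + 1 by rewrite k1; ring.
  by rewrite expRD; field; rewrite gt_eqF.
rewrite ler_pM2l ?expR_gt0 //.
have -> : gamma * k.+1%:R / k%:R = gamma * (1 + 1 / k%:R).
  by rewrite k1; field; rewrite gt_eqF.
rewrite exprMn ler_pM2l ?exprn_gt0 //.
have -> : expR 1 = expR (1 / k%:R) ^+ k :> R by rewrite -expRM_natr divfK // gt_eqF.
by apply: lerXn2r; rewrite ?nnegrE ?expR_ge0 ?addr_ge0 ?divr_ge0 ?expR_ge1Dx // ltW.
Qed.

Lemma exists_omega_le k (eps : R) : (0 < k)%N -> 0 < eps ->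
  exists gamma, 1 <= gamma /\ omega gamma k.+1 <= eps.
Proof.
(* For this x, e^x >= 1 + x^2 / 2 already gives (1 + x) e^(-x) <= eps. *)
move=> k0 eps0; pose x := 1 + 4 / eps; exists (1 + x).
have q0 : 0 < 4 / eps by rewrite divr_gt0.
have x1 : 1 <= x by rewrite /x; lra.
have g1 : 1 <= 1 + x by lra.
split => //; apply: le_trans (omega_le_decay g1 k0) _.
have d0 := decay_ge0 g1; have d1 := decay_le1 (1 + x).
apply: (@le_trans _ _ (decay (1 + x))).
  rewrite ler_pdivrMr; last by lra.
  rewrite exprS -[leRHS]mulr1 -mulrA ler_wpM2l // mulr1.
  by apply: le_trans g1; apply: exprn_ile1.
rewrite /decay (_ : 1 - (1 + x) = - x); last by ring.
rewrite expRN ler_pdivrMr ?expR_gt0 //.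
have := @expR_ge1Dxn R x 1 (le_trans ler01 x1); rewrite (_ : 2`!%:R = 2 :> R) // => e1.
apply: (@le_trans _ _ (eps * (1 + x ^+ 2 / 2))); last by rewrite ler_pM2l.
have ex : eps * x = eps + 4 by rewrite /x mulrDr mulr1 mulrC divfK // gt_eqF.
have -> : eps * (1 + x ^+ 2 / 2) = eps + (eps * x) * x / 2 by rewrite expr2; field.
rewrite ex; have := mulr_ge0 (ltW eps0) (le_trans ler01 x1); lra.
Qed.

(** A bound on alpha * s1 / t that is free of alpha: with L = 1 - omega tau, ln z <= z / e gives
    alpha ln(1 / (L alpha)) <= 1 / (e L). *)
Definition s1_bound gamma tau t : R :=
  gamma * tau / ((tau - 1) * (1 - omega gamma t * tau))
  + 1 / ((1 - omega gamma t * tau) * (expR 1 * ln tau * t%:R)).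

Lemma ln_le_div_e (z : R) : 0 < z -> ln z <= z / expR 1.
Proof.
move=> z0; rewrite -ler_expR lnK ?posrE //.
have -> : expR (z / expR 1) = expR 1 * expR (z / expR 1 - 1) :> R by rewrite -expRD addrC subrK.
apply: (@le_trans _ _ (expR 1 * (1 + (z / expR 1 - 1)))).
  by rewrite addrC subrK mulrC divfK // gt_eqF ?expR_gt0.
by rewrite ler_pM2l ?expR_gt0 // expR_ge1Dx.
Qed.

Definition s1_values alpha t : set R :=
  [set y : R | exists gamma tau : R,
        [/\ 1 <= gamma, 1 < tau, tau * omega gamma t < 1 &
         y = (gamma * tau / (tau - 1)) * (1 / (1 - omega gamma t * tau)) * (t%:R / alpha)
             + logb tau ((1 / (1 - omega gamma t * tau)) * (1 / alpha))]].

Definition s2_values alpha t : set R :=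
  [set y : R | exists B : nat, (0 < B)%N /\ y = B%:R /\
        exists gamma : R, 1 <= gamma /\ gamma * t%:R / B%:R + omega gamma t <= alpha].

Lemma s1_elem_ge0 gamma tau alpha k : (0 < k)%N -> 1 <= gamma -> 1 < tau ->
  tau * omega gamma k.+1 < 1 -> 0 < alpha -> alpha <= 1 ->
  0 <= (gamma * tau / (tau - 1)) * (1 / (1 - omega gamma k.+1 * tau)) * (k.+1%:R / alpha) /\
  0 <= logb tau ((1 / (1 - omega gamma k.+1 * tau)) * (1 / alpha)).
Proof.
move=> k0 g1 t1 tw a0 a1; have o0 := omega_gt0 g1 k0; have lt0 := ln_gt0 t1.
have w1 : 0 < 1 - omega gamma k.+1 * tau by rewrite subr_gt0 mulrC.
have w0 : 0 < omega gamma k.+1 * tau by rewrite mulr_gt0 //; lra.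
split.
  rewrite mulr_ge0 ?divr_ge0 ?ler0n ?(ltW a0) ?(ltW w1) //; last by rewrite mulr_ge0 ?divr_ge0 ?mulr_ge0 ?(ltW w1) //; lra.
rewrite divr_ge0 ?(ltW lt0) // ln_ge0 // !div1r -invfM.
by rewrite invf_ge1 ?mulr_gt0 // mulr_ile1 ?(ltW w1) ?(ltW a0) //; lra.
Qed.

Lemma s1_values_lbound alpha k : (0 < k)%N -> 0 < alpha -> alpha <= 1 ->
  lbound (s1_values alpha k.+1) 0.
Proof.
move=> k0 a0 a1 y [gamma [tau [g1 t1 tw ->]]].
by have [h1 h2] := s1_elem_ge0 k0 g1 t1 tw a0 a1; apply: addr_ge0.
Qed.

Lemma min_le_s1_bound gamma tau alpha k : (0 < k)%N -> 1 <= gamma -> 1 < tau ->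
  tau * omega gamma k.+1 < 1 -> 0 < alpha -> alpha <= 1 ->
  Num.min (alpha * s1 alpha k.+1 / k.+1%:R) (alpha * s2 alpha k.+1 / k.+1%:R)
    <= s1_bound gamma tau k.+1.
Proof.
move=> k0 g1 t1 tw a0 a1; rewrite ge_min; apply/orP; left.
have o0 := omega_gt0 g1 k0; have lt0 := ln_gt0 t1.
have w1 : 0 < 1 - omega gamma k.+1 * tau by rewrite subr_gt0 mulrC.
have T0 : 0 < k.+1%:R :> R by rewrite ltr0n.
have s1le : s1 alpha k.+1 <= (gamma * tau / (tau - 1)) * (1 / (1 - omega gamma k.+1 * tau)) * (k.+1%:R / alpha)
             + logb tau ((1 / (1 - omega gamma k.+1 * tau)) * (1 / alpha)).
  apply: ge_inf; first by exists 0; apply: s1_values_lbound.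
  by exists gamma, tau.
apply: (@le_trans _ _ (alpha * ((gamma * tau / (tau - 1)) * (1 / (1 - omega gamma k.+1 * tau)) * (k.+1%:R / alpha)
             + logb tau ((1 / (1 - omega gamma k.+1 * tau)) * (1 / alpha))) / k.+1%:R)).
  by rewrite ler_pM2r ?invr_gt0 // ler_pM2l.
set L := 1 - omega gamma k.+1 * tau in w1 *.
have zl : ln (1 / L * (1 / alpha)) <= 1 / L * (1 / alpha) / expR 1.
  by apply: ln_le_div_e; rewrite mulr_gt0 ?divr_gt0.
rewrite /s1_bound -/L.
have n1 : alpha != 0 by rewrite gt_eqF.
have n2 : L != 0 by rewrite gt_eqF.
have n3 : k.+1%:R != 0 :> R by rewrite gt_eqF.
have n4 : tau - 1 != 0 by rewrite gt_eqF // subr_gt0.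
have n5 : expR 1 != 0 :> R by rewrite gt_eqF // expR_gt0.
have n6 : ln tau != 0 by rewrite gt_eqF.
have -> : alpha * (gamma * tau / (tau - 1) * (1 / L) * (k.+1%:R / alpha)
     + logb tau (1 / L * (1 / alpha))) / k.+1%:R
  = gamma * tau / ((tau - 1) * L) + alpha / (ln tau * k.+1%:R) * ln (1 / L * (1 / alpha)).
  by rewrite /logb; field; rewrite nat1r n1 n2 n3 n4 n6.
rewrite lerD2l; apply: le_trans (ler_wpM2l _ zl) _; first by rewrite divr_ge0 ?mulr_ge0 ?ltW.
rewrite le_eqVlt; apply/orP; left; apply/eqP.
by field; rewrite nat1r n1 n2 n3 n5 n6.
Qed.

Lemma delta_le gamma tau k : (0 < k)%N -> 1 <= gamma -> 1 < tau ->
  tau * omega gamma k.+1 < 1 -> delta R k.+1 <= s1_bound gamma tau k.+1.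
Proof.
move=> k0 g1 t1 tw; apply: ge_sup.
  by eexists; exists 1; split; [exact: ltr01|exact: lexx|reflexivity].
by move=> y [alpha [a0 a1 ->]]; apply: min_le_s1_bound.
Qed.

Lemma le_delta alpha k : (0 < k)%N -> 0 < alpha -> alpha <= 1 ->
  Num.min (alpha * s1 alpha k.+1 / k.+1%:R) (alpha * s2 alpha k.+1 / k.+1%:R) <= delta R k.+1.
Proof.
move=> k0 a0 a1; apply: ub_le_sup; last by exists alpha.
have [gamma [g1 ol]] := @exists_omega_le k (1 / 4) k0 ltac:(lra).
exists (s1_bound gamma 2 k.+1) => y [alpha' [a'0 a'1 ->]].
by apply: min_le_s1_bound => //; lra.
Qed.

Lemma s1_values_neq0 alpha k : (0 < k)%N -> s1_values alpha k.+1 !=set0.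
Proof.
move=> k0; have [gamma [g1 ol]] := @exists_omega_le k (1 / 4) k0 ltac:(lra).
by eexists; exists gamma, 2; split; [exact: g1|lra|lra|reflexivity].
Qed.

Lemma s2_values_neq0 alpha k : (0 < k)%N -> 0 < alpha -> s2_values alpha k.+1 !=set0.
Proof.
move=> k0 a0; have [gamma [g1 ol]] := @exists_omega_le k (alpha / 2) k0 ltac:(lra).
have y0 : 0 <= gamma * k.+1%:R / (alpha / 2) by rewrite divr_ge0 ?mulr_ge0 //; lra.
have [B [B0 yB _]] := exists_nat_between y0.
have B0' : 0 < B%:R :> R by rewrite ltr0n.
exists B%:R, B; do 2!split => //; exists gamma; split => //.
have : gamma * k.+1%:R / B%:R <= alpha / 2.
  by rewrite ler_pdivrMr // [leRHS]mulrC -ler_pdivrMr //; lra.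
by lra.
Qed.

(** An infimum of values above t may equal t, so a uniform margin is needed. For [s2], positive
    omega forces the integer B above t. For [s1], gamma >= 2 gives a factor 2; gamma < 2 keeps omega
    at least exp(-2t), so tau is bounded and tau / (tau - 1) stays away from 1. *)
Lemma delta_gt1 k : (0 < k)%N -> 1 < delta R k.+1.
Proof.
move=> k0; apply: lt_le_trans (le_delta k0 ltr01 (lexx _)).
have T0 : 0 < k.+1%:R :> R by rewrite ltr0n.
rewrite lt_min !mul1r !ltr_pdivlMr // !mul1r; apply/andP; split; last first.
  apply: (@lt_le_trans _ _ k.+2%:R); first by rewrite ltr_nat.
  apply: lb_le_inf; first exact: s2_values_neq0.
  move=> _ [B [B0 [-> [gamma [g1 hB]]]]]; rewrite ler_nat -(ltr_nat R).
  have o0 := omega_gt0 g1 k0; have B0' : 0 < B%:R :> R by rewrite ltr0n.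
  have : gamma * k.+1%:R / B%:R < 1 by lra.
  rewrite ltr_pdivrMr // mul1r; apply: le_lt_trans; rewrite ler_peMl //; lra.
pose e : R := expR (- (2 * k.+1%:R)).
have e0 : 0 < e by apply: expR_gt0.
have e1 : e < 1 by rewrite expR_lt1 oppr_lt0 mulr_gt0.
pose m := Num.min 2 (1 / (1 - e)).
have m1 : 1 < m.
  rewrite lt_min; apply/andP; split; first by lra.
  by rewrite ltr_pdivlMr ?mul1r; lra.
apply: (@lt_le_trans _ _ (m * k.+1%:R)); first by rewrite ltr_pMl.
apply: lb_le_inf; first exact: s1_values_neq0.
move=> _ [gamma [tau [g1 t1 tw ->]]].
have [_ h2] := s1_elem_ge0 k0 g1 t1 tw ltr01 (lexx _).
have o0 := omega_gt0 g1 k0.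
rewrite -[leLHS]addr0 divr1; apply: lerD; last by rewrite !divr1 in h2 *.
rewrite ler_pM2r // -[m]mulr1; apply: ler_pM => //; first by lra.
  have [g2|g2] := leP 2 gamma.
    apply: (@le_trans _ _ 2); first by rewrite ge_min lexx.
    rewrite ler_pdivlMr; last by lra.
    apply: (@le_trans _ _ (2 * tau)); first by lra.
    by rewrite ler_pM2r; lra.
  apply: (@le_trans _ _ (1 / (1 - e))); first by rewrite ge_min lexx orbT.
  have eo : e <= omega gamma k.+1.
    apply: le_trans (omega_ge_expR g1 k0); rewrite ler_expR lerN2 ler_pM2r //; lra.
  have te : tau * e <= tau * omega gamma k.+1 by rewrite ler_pM2l //; lra.
  apply: (@le_trans _ _ (tau / (tau - 1))).
    rewrite ler_pdivrMr; last by lra.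
    by rewrite mulrAC ler_pdivlMr; lra.
  by rewrite ler_pM2r ?invr_gt0 ?ler_peMl; lra.
have w0 : 0 < omega gamma k.+1 * tau by rewrite mulr_gt0 //; lra.
by rewrite ler_pdivlMr ?mul1r; [lra|rewrite subr_gt0 mulrC].
Qed.

(** * Numerical estimates for the bound 4.75 *)

Lemma expR1_ge : 1359 / 500 <= expR 1 :> R.
Proof.
have nd : nondecreasing_seq (series (exp_coeff (1 : R))).
  apply/nondecreasing_seqP => n; rewrite /series /= big_nat_recr //= lerDl /exp_coeff /=.
  by rewrite expr1n divr_ge0.
have := nondecreasing_cvgn_le nd (@is_cvg_series_exp_coeff R 1) 7.
rewrite -/(expR 1); apply: le_trans.
rewrite /series /= !big_nat_recr //= big_geq // /exp_coeff /= !expr1n !factS fact0.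
by rewrite !mulnE /=; lra.
Qed.

(** Equality holds at t = 2, where the decay bound would only give (7/2) e^(-3), which is larger.
    For t >= 3 the cube of the decay rate suffices, with e^(3/2) >= 7/4. *)
Lemma omega_7_2_le k : (0 < k)%N -> omega (7 / 2) k.+1 * expR 2 <= 7 * expR (- 4) :> R.
Proof.
case: k => [//|[_|k _]]; have g1 : 1 <= 7 / 2 :> R by lra.
  have mu7 : 7 / 2 * 2 = 7 :> R by lra.
  have e4 : 1 - 7 + 2 = - 4 :> R by lra.
  by rewrite omegaE // mu7 /chernoff_tail expr1 divr1 mulrAC -expRD e4 mulrC.
have d0 := decay_ge0 g1; have d1 := @decay_le1 (7 / 2).
have o1 : omega (7 / 2) k.+3 <= decay (7 / 2) ^+ 3 / (7 / 2).
  apply: le_trans (omega_le_decay g1 (ltn0Sn _)) _; rewrite ler_pM2r; last by lra.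
  by apply: ler_wiXn2l.
apply: (@le_trans _ _ (decay (7 / 2) ^+ 3 / (7 / 2) * expR 2)).
  by rewrite ler_pM2r ?expR_gt0.
rewrite /decay exprMn -expRM_natr.
have -> : (1 - 7 / 2) * 3 = - 4 + (- 7 / 2) :> R by lra.
rewrite expRD.
have -> : (7 / 2) ^+ 3 * (expR (- 4) * expR (- 7 / 2)) / (7 / 2) * expR 2 =
   (49 / 4) * expR (-4) * (expR (- 7 / 2) * expR 2) :> R by field.
rewrite -expRD (_ : - 7 / 2 + 2 = - (3 / 2) :> R); last by lra.
have e32 : expR (- (3 / 2)) <= 4 / 7 :> R.
  rewrite expRN -[leRHS]invrK lef_pV2 ?posrE ?expR_gt0 ?invr_gt0 //.
  by apply: le_trans (expR_ge1Dx _); lra.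
have := ler_wpM2l (mulr_ge0 (_ : 0 <= 49 / 4 :> R) (expR_ge0 (- 4))) e32; lra.
Qed.

(** Here tau = e^2. The fractions are close rational bounds: 34/265 for 7 e^(-4), 96/83 for tau /
    (tau - 1), 23/250 for 1 / (4 e). They lead to about 4.7496, so there is little room. *)
Lemma bound_475_arith (e w T : R) : 1359 / 500 <= e -> 0 < w -> w <= 34 / 265 -> 2 <= T ->
  7 / 2 * (e * e) / ((e * e - 1) * (1 - w)) + 1 / ((1 - w) * (e * 2 * T)) <= 475 / 100.
Proof.
move=> e1 w0 w1 T2.
have e2 : 591 / 80 <= e * e.
  have : 0 <= (e - 1359 / 500) * (e + 1359 / 500) by apply: mulr_ge0; lra.
  by lra.
have eT : 1359 / 500 * 2 * 2 <= e * 2 * T.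
  have : 0 <= (e - 1359 / 500) * T by apply: mulr_ge0; lra.
  by lra.
have L0 : 0 < 1 - w by lra.
have iL : (1 - w)^-1 <= 265 / 231 by rewrite -div1r ler_pdivrMr //; lra.
have iL0 : 0 <= (1 - w)^-1 by rewrite invr_ge0 ltW.
move: (e * e) (e * 2 * T) e2 eT => s u s1 u1 {e1 T2 w0 w1}.
have s0 : 0 < s - 1 by lra.
have u0 : 0 < u by lra.
have A1 : 7 / 2 * (s / (s - 1)) <= 7 / 2 * (96 / 83).
  have : s / (s - 1) <= 96 / 83 by rewrite ler_pdivrMr //; lra.
  by lra.
have A2 : u^-1 <= 23 / 250 by rewrite -div1r ler_pdivrMr //; lra.
have -> : 7 / 2 * s / ((s - 1) * (1 - w)) + 1 / ((1 - w) * u) =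
    (7 / 2 * (s / (s - 1)) + u^-1) * (1 - w)^-1.
  by field; rewrite (gt_eqF s0) (gt_eqF u0) (gt_eqF L0).
apply: (@le_trans _ _ ((7 / 2 * (96 / 83) + 23 / 250) * (1 - w)^-1)).
  by apply: ler_wpM2r => //; lra.
apply: (@le_trans _ _ ((7 / 2 * (96 / 83) + 23 / 250) * (265 / 231))); last by lra.
by apply: ler_wpM2l; [lra|exact: iL].
Qed.

(** As tau = 1 / eta and w <= eta, the first term is at most (1 + eta) / (1 - eta)^2 <= 1 + 5 eta,
    and the second at most 1 / T <= eta. *)
Lemma bound_limit_arith (eta tau w e l T : R) : 0 < eta -> eta <= 1 / 10 -> tau * eta = 1 ->
  0 < w -> w <= eta -> 5 / 2 <= e -> 1 <= l -> tau <= T ->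
  (1 + eta) * tau / ((tau - 1) * (1 - w)) + 1 / ((1 - w) * (e * l * T)) <= 1 + 6 * eta.
Proof.
move=> eta0 eta1 te w0 w1 e1 l1 tT.
have tau0 : 0 < tau by rewrite -(pmulr_lgt0 _ eta0) te ltr01.
have L0 : 0 < 1 - w by lra.
have M0 : 0 < 1 - eta by lra.
have A1 : (1 + eta) * tau / ((tau - 1) * (1 - w)) <= 1 + 5 * eta.
  have -> : tau - 1 = tau * (1 - eta) by rewrite mulrBr te mulr1.
  have -> : (1 + eta) * tau / (tau * (1 - eta) * (1 - w)) = (1 + eta) / ((1 - eta) * (1 - w)).
    by field; rewrite (gt_eqF tau0) (gt_eqF L0) (gt_eqF M0).
  rewrite ler_pdivrMr ?mulr_gt0 //.
  apply: (@le_trans _ _ ((1 + 5 * eta) * ((1 - eta) * (1 - eta)))); last first.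
    apply: ler_wpM2l; first by clear te; lra.
    by apply: ler_wpM2l; clear te; lra.
  have h1 : 0 <= eta * (2 - 9 * eta) by apply: mulr_ge0; clear te; lra.
  have h2 : 0 <= eta * (eta * eta) by rewrite !mulr_ge0 // ltW.
  by clear te; lra.
have A2 : 1 / ((1 - w) * (e * l * T)) <= eta.
  have E0 : 1 <= (1 - w) * e.
    have h : 0 <= (1 - w - 9 / 10) * e by apply: mulr_ge0; clear te; lra.
    by clear te; lra.
  have E2 : 1 <= (1 - w) * e * l by apply: mulr_ege1.
  have T0 : 0 < T by apply: lt_le_trans tT.
  have T1 : T <= (1 - w) * (e * l * T) by rewrite !mulrA ler_peMl // ltW.
  have T2 : tau <= (1 - w) * (e * l * T) by apply: le_trans T1.
  rewrite ler_pdivrMr; last exact: lt_le_trans T2.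
  by rewrite -[leLHS]te mulrC ler_pM2l.
by apply: le_trans (lerD A1 A2) _; clear te; lra.
Qed.

Lemma delta_le_475 k : (0 < k)%N -> delta R k.+1 <= 475 / 100.
Proof.
move=> k0; have g1 : 1 <= 7 / 2 :> R by lra.
have e1 := expR1_ge; set e : R := expR 1 in e1.
have e2E : expR 2 = e * e :> R by rewrite -expRD; congr expR; lra.
have e4E : expR 4 = e * e * (e * e) :> R by rewrite -e2E -expRD; congr expR; lra.
have e2 : 591 / 80 <= e * e.
  by apply: le_trans (ler_pM _ _ e1 e1); lra.
have e4 : 1364 / 25 <= e * e * (e * e).
  by apply: le_trans (ler_pM _ _ e2 e2); lra.
pose w : R := omega (7 / 2) k.+1 * expR 2.
have w0 : 0 < w by rewrite mulr_gt0 ?expR_gt0 // omega_gt0.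
have w1 : w <= 34 / 265.
  apply: le_trans (omega_7_2_le k0) _; rewrite expRN e4E ler_pdivrMr; lra.
have t1 : 1 < expR 2 :> R by rewrite e2E; lra.
apply: le_trans (@delta_le (7 / 2) (expR 2) k k0 g1 t1 _) _; first by rewrite mulrC -/w; lra.
rewrite /s1_bound -/w -/e expRK.
rewrite e2E; apply: bound_475_arith => //.
by rewrite ler_nat.
Qed.

(** * The limit of [delta] *)

Lemma decay_lt1 gamma : 1 < gamma -> decay gamma < 1.
Proof.
move=> g1; rewrite /decay -opprB expRN ltr_pdivrMr ?expR_gt0 // mul1r.
by have := @expR_gt1Dx R (gamma - 1); rewrite gt_eqF ?subr_gt0 // => /(_ isT); lra.
Qed.

Lemma exp_decay_le (rho eps : R) : 0 < rho -> rho < 1 -> 0 < eps ->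
  exists N, forall n, (N <= n)%N -> rho ^+ n <= eps.
Proof.
move=> r0 r1 e0; pose x := rho^-1 - 1.
have x0 : 0 < x by rewrite subr_gt0 invf_gt1.
exists (Num.truncn (1 / (eps * x))).+1 => n Nn.
have nx : 1 / (eps * x) <= n%:R.
  by apply: le_trans (ltW (truncnS_gt _)) _; rewrite ler_nat.
have xE : 1 + x = rho^-1 by rewrite /x addrC subrK.
have := @bernoulli_ineq R x n (ltW x0); rewrite xE exprVn => bn.
rewrite -[leLHS]invrK -[leRHS]invrK lef_pV2 ?posrE ?invr_gt0 ?exprn_gt0 //.
apply: le_trans bn; move: nx; rewrite ler_pdivrMr ?mulr_gt0 // => nx.
rewrite -[eps^-1]mul1r ler_pdivrMr //.
have -> : (1 + n%:R * x) * eps = eps + n%:R * (eps * x) by ring.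
lra.
Qed.

Lemma delta_cvg1 : delta R t @[t --> \oo] --> (1 : R).
Proof.
apply/cvgrPdist_le => eps eps0.
pose eta : R := Num.min (1 / 10) (eps / 6).
have eta0 : 0 < eta by rewrite lt_min; lra.
have eta1 : eta <= 1 / 10 by rewrite ge_min lexx.
have eta2 : eta <= eps / 6 by rewrite ge_min lexx orbT.
have g1 : 1 < 1 + eta by lra.
have rho0 : 0 < decay (1 + eta) by rewrite mulr_gt0 ?expR_gt0 //; lra.
have [N1 hN1] := exp_decay_le rho0 (decay_lt1 g1) (mulr_gt0 eta0 eta0).
pose N2 := (Num.truncn (1 / eta)).+1.
exists (maxn N1 N2).+2 => // t /= tN.
case: t tN => [//|k] tN.
have k0 : (0 < k)%N by lia.
have d1 := delta_gt1 k0.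
rewrite distrC ger0_norm; last by lra.
suff : delta R k.+1 <= 1 + 6 * eta by lra.
have T0 : 1 / eta <= k.+1%:R.
  apply: le_trans (ltW (truncnS_gt _)) _; rewrite ler_nat -/N2; lia.
(* The square compensates the later factor tau = 1 / eta. *)
have om : omega (1 + eta) k.+1 <= eta * eta.
  apply: le_trans (omega_le_decay (ltW g1) k0) _.
  apply: le_trans (hN1 k.+1 _); last by lia.
  rewrite ler_pdivrMr; last by lra.
  by rewrite ler_peMr ?exprn_ge0 ?(ltW rho0) ?(ltW g1).
pose tau := eta^-1.
have te : tau * eta = 1 by rewrite mulVf // gt_eqF.
have tau10 : 10 <= tau.
  by rewrite /tau -div1r ler_pdivlMr //; lra.
pose w := omega (1 + eta) k.+1 * tau.
have w0 : 0 < w by rewrite mulr_gt0 ?omega_gt0 //; lra.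
have w1 : w <= eta.
  have : w <= eta * eta * tau by rewrite ler_pM2r //; lra.
  by rewrite -mulrA [eta * tau]mulrC te mulr1.
have t1 : 1 < tau by lra.
apply: le_trans (@delta_le (1 + eta) tau k k0 (ltW g1) t1 _) _; first by rewrite mulrC -/w; lra.
rewrite /s1_bound -/w.
have e1 := expR1_ge.
have lt1 : 1 <= ln tau.
  rewrite -[1](@expRK R) ler_ln ?posrE ?expR_gt0 //; last by lra.
  by have := expR1_lt3 R; lra.
apply: bound_limit_arith => //; first by lra.
by rewrite /tau -div1r.
Qed.

End Delta.

(** A smallest undominated set is at most every value under either infimum, hence at most [s1] and
    [s2] themselves; attainment of the infima is thus avoided. *)
Lemma exists_undominated_le_delta (R : realType) (k : nat) (alpha : R) (V A : finType)
    (pref : V -> rel A) :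
  (0 < k)%N -> 0 < alpha -> alpha <= 1 -> is_election pref -> (k < #|A|)%N ->
  exists C : {set A}, undominated pref k.+1 alpha C /\
    (#|C|%:Z <= Num.floor (delta R k.+1 * k.+1%:R / alpha))%R.
Proof.
move=> k0 a0 a1 [_ lin] kA.
have T0 : 0 < k.+1%:R :> R by rewrite ltr0n.
pose P (C : {set A}) := `[< (k < #|C|)%N /\ undominated_in pref k [set: V]%SET alpha C >].
have reach X : achievable pref k alpha X -> exists2 C, P C & #|C|%:R <= X.
  by move=> /(_ [set: V]%SET) [C [kC CX uC]]; exists C => //; apply/asboolP.
have s1P y : s1_values alpha k.+1 y -> achievable pref k alpha y.
  move=> [gamma [tau [g1 t1 tw ->]]].
  have w1 : 0 < 1 - omega gamma k.+1 * tau by rewrite subr_gt0 mulrC.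
  have := @achievable_stages R V A pref k lin k0 kA (gamma * k.+1%:R) tau alpha.
  rewrite /stage_total -omegaE // [omega _ _ * tau]mulrC => /(_ _ t1 tw a0 a1).
  rewrite mulrC in w1; set L := 1 - _ in w1 *.
  have -> : 1 / L * (1 / alpha) = 1 / (L * alpha) by rewrite !div1r invfM.
  have -> : gamma * tau / (tau - 1) * (1 / L) * (k.+1%:R / alpha) =
     gamma * k.+1%:R * tau / ((tau - 1) * L * alpha).
    by field; rewrite (gt_eqF w1) (gt_eqF a0) gt_eqF // subr_gt0.
  by apply; rewrite ler_peMl // ltW.
have s2P y : s2_values alpha k.+1 y -> achievable pref k alpha y.
  move=> [B [B0 [-> [gamma [g1]]]]]; rewrite omegaE //.
  by apply: achievable_one_stage => //; rewrite ler_peMl // ltW.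
have [y0 /s1P /reach [C0 PC0 _]] := @s1_values_neq0 R alpha k k0.
have [C PC Cmin] := @arg_minnP _ C0 P (fun C : {set A} => #|C|) PC0.
have Cle y : achievable pref k alpha y -> #|C|%:R <= y.
  by move=> /reach [D PD]; apply: le_trans; rewrite ler_nat Cmin.
have Cs1 : #|C|%:R <= s1 alpha k.+1.
  by apply: lb_le_inf; [exact: s1_values_neq0|move=> y /s1P /Cle].
have Cs2 : #|C|%:R <= s2 alpha k.+1.
  by apply: lb_le_inf; [exact: s2_values_neq0|move=> y /s2P /Cle].
have /asboolP [kC uC] := PC.
exists C; split; last first.
  rewrite floor_ge_int ler_pdivlMr // -ler_pdivrMr //.
  apply: le_trans (le_delta k0 a0 a1).
  by rewrite le_min !ler_pM2r ?invr_gt0 // ![_ * alpha]mulrC !ler_pM2l // Cs1.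
split => // a aC; rewrite floor_ge_int; have := uC a aC; rewrite cardsT.
(* The set of voters in [undominated] is a classical set. *)
suff <- : #|[set v : V | ~~ beats_t pref k.+1 v C a]| =
  #|[set v in [set: V] | ~~ beats_t pref k.+1 v C a]%SET| by [].
by apply: eq_card => v; rewrite [RHS]inE in_setT andTb; apply/asboolP/idP.
Qed.

Theorem theorem2 (R : realType) :
  (forall t : nat, (2 <= t)%N ->
    (forall (alpha : R), 0 < alpha -> alpha <= 1 ->
     forall (V A : finType) (pref : V -> rel A),
       is_election pref -> (t <= #|A|)%N ->
       exists C : {set A}, undominated pref t alpha C /\
         ((#|C|)%:Z <= Num.floor (delta R t * t%:R / alpha))%R)
    /\ (1 < delta R t /\ delta R t <= 475 / 100))
  /\ (delta R t @[t --> \oo] --> (1 : R)).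
Proof.
split; last exact: delta_cvg1.
move=> [//|[//|k]] _; split; last by split; [exact: delta_gt1|exact: delta_le_475].
by move=> alpha a0 a1 V A pref el cA; apply: exists_undominated_le_delta.
Qed.
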